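(* Let $\vec F_{3,3}$ be an anti-directed orientation of $F_{3,3}$. Then for all sufficiently large $n$, $$D(n,\vec F_{3,3})=2^{\mathrm{ex}(n,F_{3,3})}=2^{\lfloor n^2/4\rfloor+6}.$$
   Context: $F_{3,3}$ is the graph consisting of three triangles sharing exactly one common vertex (the center). An orientation of $F_{3,3}$ is anti-directed if each of the three triangles contains at least one edge directed into the center and at least one edge directed out of the center. For a directed graph $\vec H$, $D(n,\vec H)$ is the maximum, over all $n$-vertex graphs $G$, of the number of orientations of $G$ containing no copy of $\vec H$; $\mathrm{ex}(n,F)$ is the Turán number of $F$. *)

(* Defs.v *)
From mathcomp Require Import all_boot.
Set Implicit Arguments. Unset Strict Implicit. Unset Printing Implicit Defensive.

(* A (di)graph on a finite vertex type V is a boolean relation on V.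
   Graphs on n vertices: vertex set 'I_n, encoded as finite functions on pairs
   (so that they form a finType and can be counted / maximized over). *)
Definition grel n := {ffun 'I_n * 'I_n -> bool}.
Definition rel_of n (G : grel n) : rel 'I_n := fun x y => G (x, y).

Definition simpleb (V : finType) (G : rel V) : bool :=
  [forall x, ~~ G x x] && [forall x, forall y, G x y == G y x].

Definition orientationb (V : finType) (G D : rel V) : bool :=
  [forall x, forall y, (G x y ==> (D x y (+) D y x)) && (D x y ==> G x y)].

Definition has_copy (W : finType) (F : rel W) n (G : rel 'I_n) : bool :=
  [exists f : {ffun W -> 'I_n},
     injectiveb f && [forall u, forall v, F u v ==> G (f u) (f v)]].

Definition nedges n (G : rel 'I_n) : nat :=
  #|[set p : 'I_n * 'I_n | G p.1 p.2 && (p.1 < p.2)]|.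

Definition ex (W : finType) (F : rel W) n : nat :=
  \max_(G : grel n | simpleb (rel_of G) && ~~ has_copy F (rel_of G))
     nedges (rel_of G).

Definition Dnum (W : finType) (H : rel W) n : nat :=
  \max_(G : grel n | simpleb (rel_of G))
     #|[set D : grel n | orientationb (rel_of G) (rel_of D)
                         && ~~ has_copy H (rel_of D)]|.

(* F_{3,3} on vertex set 'I_7: centre 0, triangles {0,1,2}, {0,3,4}, {0,5,6}. *)
Definition F33 : rel 'I_7 := fun u v =>
  (u != v) && [|| (u == 0 :> nat), (v == 0 :> nat) | ((u.-1)./2 == (v.-1)./2)].

Definition centre : 'I_7 := ord0.

(* anti-directed orientation of F_{3,3}: for each triangle t (non-centre
   vertices 2t+1, 2t+2), some edge of it is directed into the centre and some
   edge is directed out of the centre. *)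
Definition anti_directed (H : rel 'I_7) : Prop :=
  orientationb F33 H /\
  forall t : 'I_3,
    (exists v : 'I_7, [/\ (v.-1)./2 = t, v != centre & H v centre]) /\
    (exists v : 'I_7, [/\ (v.-1)./2 = t, v != centre & H centre v]).

(* Main.v *)
Require Import Defs.
From mathcomp Require Import all_boot.
From mathcomp Require Import zify.
Set Implicit Arguments. Unset Strict Implicit. Unset Printing Implicit Defensive.

(** If some vertex v of an m-vertex graph G satisfies
    2 N(G) <= 2^(m/2) N(G - v), where N counts the H-free orientations, delete v;
    iterating this from a large graph contradicts the trivial bound on N, so one may
    assume that no vertex yields such a gain.  Then every degree is at least m/2.

    By Pajor's lemma the patterns at v extending a fixed orientation of G - v are no
    more numerous than the subsets of N(v) spanning no three disjoint edges, hence
    (up to a polynomial factor) than the independent subsets of N(v).  As there must be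
    about 2^(m/2) of them, the Kleitman-Winston algorithm finds almost m/2 vertices
    in N(v) inducing a graph of small maximal degree.  So G is nearly complete
    bipartite with parts A and B.

    Call a family of H-free orientations negligible if it is exponentially rarer than
    all of them; a family in which some vertex has, given the rest, at most
    2^(m/2 - s) patterns with s large is negligible, again because deleting that
    vertex does not gain.  This shows that A and B induce graphs with maximal degree
    at most 2 and no three disjoint edges, hence with at most 6 edges each.  If A and B
    together contain at most 6 edges, then G has at most m^2/4 + 6 edges.  Otherwise
    both contain edges, and in all but negligibly many orientations a vertex of A with
    two neighbours in A spans no triangle of a certain type with an edge of B: these
    constraints outweigh the additional edges. *)

(** * Set families, small subsets and independent sets *)

Definition shatters (T : finType) (F : {set {set T}}) (A : {set T}) :=
  [forall B : {set T}, (B \subset A) ==> [exists C in F, C :&: A == B]].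

Lemma shattersP (T : finType) (F : {set {set T}}) (A : {set T}) :
  reflect (forall B : {set T}, B \subset A -> exists2 C, C \in F & C :&: A = B)
          (shatters F A).
Proof.
apply: (iffP forallP) => [H B sBA | H B].
  by have /implyP/(_ sBA)/exists_inP[C CF /eqP CB] := H B; exists C.
by apply/implyP => /H[C CF CB]; apply/exists_inP; exists C; rewrite ?CB.
Qed.

Lemma shatters_sub (T : finType) (F F' : {set {set T}}) (A : {set T}) :
  F \subset F' -> shatters F A -> shatters F' A.
Proof.
move=> /subsetP sF /shattersP H; apply/shattersP => B /H[C CF CB].
by exists C => //; apply: sF.
Qed.

(* Pajor's form of the Sauer-Shelah lemma. *)
Lemma pajor (T : finType) (F : {set {set T}}) :
  #|F| <= #|[set A | shatters F A]|.
Proof.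
have [k] := ubnP #|[set: T]|; have: F \subset powerset [set: T].
  by apply/subsetP => A _; rewrite powersetE subsetT.
elim: k [set: T] F => // k IHk E F sFE ltEk.
case: (set_0Vmem E) sFE ltEk => [-> | [e eE]] sFE ltEk.
  have [-> | [C CF]] := set_0Vmem F; first by rewrite cards0.
  have sF: F \subset [set set0] by rewrite -powerset0.
  rewrite (leq_trans (subset_leq_card sF)) // cards1 card_gt0.
  apply/set0Pn; exists set0; rewrite inE; apply/shattersP => B.
  by rewrite subset0 => /eqP->; exists C; rewrite ?setI0.
pose F0 := [set C in F | e \notin C].
pose F1 := [set C :\ e | C in [set C in F | e \in C]].
have sF0 : F0 \subset powerset (E :\ e).
  apply/subsetP => C; rewrite inE powersetE subsetD1 => /andP[CF ->].
  by rewrite andbT -powersetE (subsetP sFE).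
have sF1 : F1 \subset powerset (E :\ e).
  apply/subsetP => C /imsetP[C']; rewrite inE powersetE => /andP[CF _ ->].
  by rewrite setSD // -powersetE (subsetP sFE).
have ltEe : #|E :\ e| < k by move: ltEk; rewrite (cardsD1 e) eE.
have notin_sh (F' : {set {set T}}) A : F' \subset powerset (E :\ e) -> shatters F' A -> e \notin A.
  move=> sF' /shattersP/(_ A (subxx A))[C /(subsetP sF')].
  rewrite powersetE subsetD1 => /andP[_ eC] CA; apply: contra eC.
  by rewrite -CA inE => /andP[].
have F1E C : C \in F1 -> e |: C \in F.
  by case/imsetP => C'; rewrite inE => /andP[CF eC] ->; rewrite setD1K.
pose S0 := [set A | shatters F0 A]; pose S1 := [set A | shatters F1 A].
have cardF : #|F| = #|F0| + #|F1|.
  rewrite card_in_imset; last first.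
    move=> C C'; rewrite !inE => /andP[_ eC] /andP[_ eC'] eq.
    by rewrite -(setD1K eC) -(setD1K eC') eq.
  rewrite -(cardsID [set C : {set T} | e \in C] F) addnC; congr (_ + _); apply: eq_card => C.
    by rewrite !inE andbC.
  by rewrite !inE.
have := IHk _ _ sF0 ltEe; have := IHk _ _ sF1 ltEe; rewrite -/S0 -/S1 => H1 H0.
(* A set [A] shattered by both families is counted twice. Its second copy becomes [e |: A], for
   which [F0] supplies the traces without [e] and [F1] those with [e]. *)
rewrite cardF (leq_trans (leq_add H0 H1)) // -cardsUI.
have inj : {in S0 :&: S1 &, injective (fun A => e |: A)}.
  move=> A A'; rewrite !inE => /andP[/(notin_sh _ _ sF0) eA _] /andP[/(notin_sh _ _ sF0) eA' _] eq.
  by rewrite -(setU1K eA) -(setU1K eA') eq.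
rewrite -(card_in_imset inj) -cardsUI.
have -> : (S0 :|: S1) :&: [set e |: A | A in S0 :&: S1] = set0.
  apply/setP => A; rewrite !inE; apply/negP => /andP[H /imsetP[A' _ eqA]].
  have : e \notin A by case/orP: H => /notin_sh; apply.
  by rewrite eqA !inE eqxx.
rewrite cards0 addn0; apply: subset_leq_card; apply/subsetP => A.
case/setUP => [/setUP[] | /imsetP[A']]; rewrite !inE.
- by apply: shatters_sub; apply/subsetP => C; rewrite inE => /andP[].
- move=> shA; have eA := notin_sh _ _ sF1 shA.
  apply/shattersP => B sBA.
  have /shattersP/(_ _ sBA)[C CF <-] := shA.
  exists (e |: C); first exact: F1E.
  apply/setP => z; rewrite !inE; case: eqP => //= ->.
  by rewrite (negPf eA) !andbF.
case/andP => sh0 sh1 ->; have eA := notin_sh _ _ sF1 sh1.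
apply/shattersP => B sBA.
have [eB | eB] := boolP (e \in B).
  have sB : B :\ e \subset A'.
    apply/subsetP => z; rewrite !inE => /andP[ze zB].
    by have := subsetP sBA _ zB; rewrite !inE (negPf ze).
  have /shattersP/(_ _ sB)[C CF eqC] := sh1.
  exists (e |: C); first exact: F1E.
  by rewrite -setUIr eqC setD1K.
have sB : B \subset A'.
  apply/subsetP => z zB; have := subsetP sBA _ zB; rewrite !inE.
  by case/orP => // /eqP ez; rewrite -ez zB in eB.
have /shattersP/(_ _ sB)[C] := sh0; rewrite inE => /andP[CF eC] <-.
exists C => //; apply/setP => z; rewrite !inE; case: eqP => //= ->.
by rewrite (negPf eC).
Qed.

Lemma card_small_subsets (T : finType) (X : {set T}) k :
  #|[set U : {set T} | (U \subset X) && (#|U| <= k)]| <= #|X|.+1 ^ k.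
Proof.
elim: k => [|k IHk].
  rewrite expn0 -(cards1 (set0 : {set T})).
  apply: subset_leq_card; apply/subsetP => U; rewrite !inE => /andP[_].
  by rewrite leqn0 cards_eq0.
pose A := [set U : {set T} | (U \subset X) && (#|U| <= k)].
pose B := [set u.1 |: u.2 | u in setX X A].
apply: (@leq_trans #|A :|: B|).
  apply: subset_leq_card; apply/subsetP => U; rewrite !inE => /andP[sUX].
  rewrite leq_eqVlt sUX ltnS => /orP[/eqP cU | ->] //.
  have [x xU] : exists x, x \in U by apply/card_gt0P; rewrite cU.
  apply/orP; right; apply/imsetP; exists (x, U :\ x); last by rewrite /= setD1K.
  rewrite !inE (subsetP sUX) //= (subset_trans (subD1set _ _)) //=.
  by move: cU; rewrite (cardsD1 x) xU; lia.
rewrite (leq_trans (leq_card_setU _ _)) // expnS mulSn leq_add //.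
by rewrite (leq_trans (leq_imset_card _ _)) // cardsX leq_mul2l IHk orbT.
Qed.

Definition indep (T : finType) (G : rel T) (I : {set T}) :=
  [forall x in I, forall y in I, ~~ G x y].

Lemma indepP (T : finType) (G : rel T) (I : {set T}) :
  reflect {in I &, forall x y, ~~ G x y} (indep G I).
Proof.
apply: (iffP forall_inP) => [H x y xI yI | H x xI].
  by have /forall_inP := H x xI; apply.
by apply/forall_inP => y yI; apply: H.
Qed.

Definition indsets (T : finType) (G : rel T) (C : {set T}) :=
  [set I in powerset C | indep G I].

(* Kleitman-Winston: branch on a vertex of large degree. *)
Lemma card_indsets (T : finType) (G : rel T) (m e : nat) (C : {set T}) :
  0 < e ->
  (forall C' : {set T}, C' \subset C -> m <= #|C'| ->
     exists2 w, w \in C' & e <= #|[set y in C' | (y != w) && G w y]|) ->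
  #|indsets G C| <= 2 ^ m * #|C|.+1 ^ (#|C| %/ e).
Proof.
move=> e_gt0; have [k] := ubnP #|C|; elim: k C => // k IHk C ltCk H.
have [mC | Cm] := leqP m #|C|; last first.
  have: #|indsets G C| <= #|powerset C|.
    by apply: subset_leq_card; apply/subsetP => I; rewrite inE => /andP[].
  move/leq_trans; apply; rewrite card_powerset.
  by rewrite (@leq_trans (2 ^ m)) ?leq_exp2l ?(ltnW Cm) // leq_pmulr ?expn_gt0.
have [w wC degw] := H C (subxx C) mC.
set Nw := [set y in C | _] in degw.
have sN : Nw \subset C :\ w.
  by apply/subsetP => y; rewrite !inE => /and3P[-> -> _].
pose C1 := C :\ w; pose C2 := C1 :\: Nw.
have cC : #|C| = #|C1|.+1 by rewrite (cardsD1 w) wC.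
have cC1 : #|C1| = #|Nw| + #|C2| by rewrite -(cardsID Nw C1) (setIidPr sN).
have sub1 : C1 \subset C by apply: subD1set.
have sub2 : C2 \subset C by apply: subset_trans sub1; apply: subsetDl.
have IH1 : #|indsets G C1| <= 2 ^ m * #|C1|.+1 ^ (#|C1| %/ e).
  apply: IHk => [|C' sC' mC']; first by lia.
  by apply: H => //; apply: subset_trans sub1.
have IH2 : #|indsets G C2| <= 2 ^ m * #|C2|.+1 ^ (#|C2| %/ e).
  apply: IHk => [|C' sC' mC']; first by lia.
  by apply: H => //; apply: subset_trans sub2.
have split : indsets G C \subset indsets G C1 :|: [set w |: I | I in indsets G C2].
  apply/subsetP => I; rewrite !inE => /andP[sIC iI].
  have [wI | wI] := boolP (w \in I); last by rewrite subsetD1 sIC wI iI.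
  apply/orP; right; apply/imsetP; exists (I :\ w); last by rewrite setD1K.
  rewrite !inE; apply/andP; split.
    apply/subsetP => y; rewrite !inE => /andP[yw yI].
    rewrite yw (subsetP sIC) //= andbT.
    by have /indepP/(_ w y wI yI) := iI.
  apply/indepP => y z; rewrite !inE => /andP[_ yI] /andP[_ zI].
  by have /indepP/(_ y z yI zI) := iI.
rewrite (leq_trans (subset_leq_card split)) // (leq_trans (leq_card_setU _ _)) //.
rewrite (leq_trans (leq_add IH1 (leq_trans (leq_imset_card _ _) IH2))) //.
rewrite -mulnDr leq_mul2l; apply/orP; right.
(* Taking [w] discards at least [e] neighbours, so the exponent for [C2] is smaller by one, and
   [c ^ q.+1 + c ^ q <= c.+1 ^ q.+1]. *)
set c := #|C|; have q_gt0 : 0 < c %/ e by rewrite divn_gt0 // /c; lia.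
rewrite -(prednK q_gt0); set q := (c %/ e).-1.
have c_gt0 : 0 < c by rewrite /c cC.
have b1 : #|C1|.+1 ^ (#|C1| %/ e) <= c ^ q.+1.
  by rewrite -cC leq_pexp2l // /q prednK // leq_div2r // subset_leq_card.
have b2 : #|C2|.+1 ^ (#|C2| %/ e) <= c ^ q.
  apply: (@leq_trans (c ^ (#|C2| %/ e))).
    by case: (_ %/ _) => // i; rewrite leq_exp2r // /c; lia.
  rewrite leq_pexp2l // -ltnS /q prednK //.
  have : (#|C2| + e) %/ e <= c %/ e by rewrite leq_div2r // /c; lia.
  by rewrite divnDr // divnn e_gt0 addn1.
rewrite (leq_trans (leq_add b1 b2)) // expnS -mulSnr expnS leq_mul2l orFb.
by case: q {b1 b2} => // i; rewrite leq_exp2r.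
Qed.

(** * Orientations avoiding H *)

Lemma card_gt_notin (T : finType) (A : {set T}) (s : seq T) :
  size s < #|A| -> exists2 x, x \in A & x \notin s.
Proof.
move=> lt; have /subsetPn[x xA xs] : ~~ (A \subset [set y in s]).
  apply: contraL lt => /subset_leq_card le; rewrite -leqNgt (leq_trans le) //.
  by rewrite cardsE card_size.
by exists x => //; rewrite inE in xs.
Qed.

Lemma card_bigcup_le (I T : finType) (A : {set I}) (F : I -> {set T}) :
  #|\bigcup_(i in A) F i| <= \sum_(i in A) #|F i|.
Proof.
elim/big_rec2: _ => [|i m B _ IH]; first by rewrite cards0.
by rewrite (leq_trans (leq_card_setU _ _)) // leq_add2l.
Qed.

Lemma card_le_fibers (T U : finType) (P : {set T}) (f : T -> U) (R : {set U}) E :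
  (forall x, x \in P -> f x \in R) ->
  (forall u, #|[set x in P | f x == u]| <= E) -> #|P| <= E * #|R|.
Proof.
move=> fR fE; have sP : P \subset \bigcup_(u in R) [set x in P | f x == u].
  by apply/subsetP => x xP; apply/bigcupP; exists (f x); rewrite ?inE ?xP ?eqxx ?fR.
rewrite (leq_trans (subset_leq_card sP)) // (leq_trans (card_bigcup_le _ _)) //.
by rewrite mulnC -sum_nat_const leq_sum.
Qed.

Lemma mem_choices (T : finType) (a0 b0 a1 b1 a2 b2 : T) (c0 c1 c2 : bool) (B : {set T}) :
  B = [set if c0 then a0 else b0; if c1 then a1 else b1; if c2 then a2 else b2] ->
  uniq [:: a0; b0; a1; b1; a2; b2] ->
  [/\ (a0 \in B) = c0, (a1 \in B) = c1 & (a2 \in B) = c2] /\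
  [/\ (b0 \in B) = ~~ c0, (b1 \in B) = ~~ c1 & (b2 \in B) = ~~ c2].
Proof.
move=> ->; rewrite /= !inE !negb_or -!andbA => /and5P[? ? ? ? /and5P[? ? ? ?]].
case/and5P=> ? ? ? ? /and4P[? ? ? _].
by case: c0; case: c1; case: c2; split; split; rewrite ?inE ?eqxx ?orbT //=;
   apply/negbTE; rewrite !negb_or; apply/andP; split=> //; try (apply/andP; split=> //);
   rewrite eq_sym.
Qed.

Section Orientations.
Variable V : finType.
Implicit Types (G : rel V) (X Y Z : {set V}) (x y a b v : V).
Notation digraph := {ffun V * V -> bool}.
Implicit Types (D : digraph) (t s : bool).

Definition nbr G x : {set V} := [set y | G x y].
Definition out D x : {set V} := [set y | D (x, y)].
Definition orients G D := orientationb G (fun x y => D (x, y)).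

(* The triangle [x, a, b] is anti-directed at [x]; it is cyclic if [t] and
   transitive otherwise. *)
Definition tri t D x a b :=
  [&& D (x, a), D (b, x) & if t then D (a, b) else D (b, a)] ||
  [&& D (x, b), D (a, x) & if t then D (b, a) else D (a, b)].

Lemma orientsP G D : symmetric G ->
  reflect ((forall x y, G x y -> D (y, x) = ~~ D (x, y)) /\
           (forall x y, D (x, y) -> G x y)) (orients G D).
Proof.
move=> symG; apply: (iffP forallP) => [H | [H1 H2] x].
  split=> x y; have /forallP/(_ y)/andP[/implyP H1 /implyP] := H x => //.
  by move=> _ Gxy; have := H1 Gxy; case: (D (x, y)); case: (D (y, x)).
apply/forallP => y; apply/andP; split; apply/implyP; last exact: H2.
by move=> /H1->; case: (D _).
Qed.

Lemma orients_nedge G D x y : orients G D -> ~~ G x y -> D (x, y) = false.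
Proof.
move/forallP/(_ x)/forallP/(_ y)/andP => [_ /implyP H] nG.
by apply: contraNF nG.
Qed.

(** The triangle is anti-directed at [x] when its two arcs at [x] differ in direction, and reversing
    the edge [ab] then exchanges the two types. With the arcs at [x] fixed, the type is thus a
    single bit. *)
Lemma triE G D t x a b : symmetric G -> orients G D -> G x a -> G x b -> G a b ->
  tri t D x a b = (D (x, b) != D (x, a)) && (D (a, b) == (D (x, a) == t)).
Proof.
move=> symG /(orientsP _ symG)[H _] xa xb ab; rewrite /tri.
rewrite (H _ _ xa) (H _ _ xb) (H _ _ ab).
by case: t; case: (D (x, a)); case: (D (x, b)); case: (D (a, b)).
Qed.

Variables t0 t1 t2 : bool.

Definition Hfree D :=
  ~~ [exists x, exists a0, exists b0, exists a1, exists b1, exists a2, exists b2,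
      [&& uniq [:: x; a0; b0; a1; b1; a2; b2], tri t0 D x a0 b0,
          tri t1 D x a1 b1 & tri t2 D x a2 b2]].

Lemma HfreeP D :
  reflect (forall x a0 b0 a1 b1 a2 b2, uniq [:: x; a0; b0; a1; b1; a2; b2] ->
    tri t0 D x a0 b0 -> tri t1 D x a1 b1 -> tri t2 D x a2 b2 -> False)
  (Hfree D).
Proof.
apply: (iffP negP) => [H x a0 b0 a1 b1 a2 b2 U T0 T1 T2 | H].
  apply: H; do 3![apply/existsP; eexists]; do 4![apply/existsP; eexists].
  by apply/and4P; split; [exact: U | exact: T0 | exact: T1 | exact: T2].
case/existsP=> x /existsP[a0 /existsP[b0 /existsP[a1 /existsP[b1]]]].
by case/existsP=> a2 /existsP[b2 /and4P[]]; apply: H.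
Qed.

Definition Horients G : {set digraph} := [set D | orients G D && Hfree D].

Lemma Hfree_mono D D' : (forall p, D' p -> D p) -> Hfree D -> Hfree D'.
Proof.
move=> sD /HfreeP H; apply/HfreeP => x a0 b0 a1 b1 a2 b2 U.
have mono t a b : tri t D' x a b -> tri t D x a b.
  rewrite /tri; case: t => /orP[] /and3P[/sD-> /sD-> /sD->] //; by rewrite orbT.
by move=> /mono T0 /mono T1 /mono T2; apply: (H _ _ _ _ _ _ _ U).
Qed.

(** Deletion isolates [v] instead of changing the vertex type, so that all graphs of the induction
    live on one type; a set [X] later records the vertices still in play. *)
Definition delG v G : rel V := fun x y => [&& G x y, x != v & y != v].
Definition delD v D : digraph := [ffun p => [&& D p, p.1 != v & p.2 != v]].

Lemma delG_sym v G : symmetric G -> symmetric (delG v G).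
Proof. by move=> symG x y; rewrite /delG symG (andbC (x != v)). Qed.

Lemma delG_irr v G : irreflexive G -> irreflexive (delG v G).
Proof. by move=> irrG x; rewrite /delG irrG. Qed.

Lemma delD_eq v D D' x y : x != v -> y != v -> delD v D = delD v D' -> D (x, y) = D' (x, y).
Proof. by move=> xv yv /ffunP/(_ (x, y)); rewrite !ffunE /= xv yv !andbT. Qed.

Lemma Horients_del G D v : D \in Horients G -> delD v D \in Horients (delG v G).
Proof.
rewrite !inE => /andP[/forallP oD fD]; apply/andP; split; last first.
  by apply: Hfree_mono fD => p; rewrite ffunE => /andP[].
apply/forallP => x; apply/forallP => y; rewrite !ffunE /delG /=.
have /forallP/(_ y) := oD x.
by case: (x != v); case: (y != v); rewrite ?andbF ?andbT.
Qed.

Lemma orients_fiber_inj G D D' v : symmetric G -> orients G D -> orients G D' ->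
  delD v D = delD v D' -> out D v = out D' v -> D = D'.
Proof.
move=> symG oD oD' eqdel eqout; apply/ffunP => -[x y].
have Ev z : D (v, z) = D' (v, z) by have /setP/(_ z) := eqout; rewrite !inE.
have [-> // | xv] := eqVneq x v; have [-> | yv] := eqVneq y v; last exact: delD_eq eqdel.
have [Gvx | nG] := boolP (G v x).
  have /(orientsP _ symG)[H _] := oD; have /(orientsP _ symG)[H' _] := oD'.
  by rewrite (H _ _ Gvx) (H' _ _ Gvx) Ev.
by rewrite !(orients_nedge oD, orients_nedge oD') // symG.
Qed.

(** An orientation is determined by its restriction to [G - v] and the pattern [out D v]. A uniform
    bound on the patterns therefore bounds the cost of restoring [v]. *)
Lemma card_star_extensions G v (P : {set digraph}) E : symmetric G ->
  P \subset Horients G ->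
  (forall D0, #|[set out D v | D in [set D in P | delD v D == D0]]| <= E) ->
  #|P| <= E * #|Horients (delG v G)|.
Proof.
move=> symG /subsetP sP fE; apply: (card_le_fibers (f := delD v)).
  by move=> D /sP; apply: Horients_del.
move=> D0; rewrite -(card_in_imset (f := fun D => out D v)) //.
move=> D D'; rewrite !inE => /andP[/sP + /eqP eD] /andP[/sP + /eqP eD'].
rewrite !inE => /andP[oD _] /andP[oD' _]; apply: (orients_fiber_inj symG oD oD').
by rewrite eD.
Qed.

Lemma out_sub_nbr G D v : orients G D -> out D v \subset nbr G v.
Proof.
move/forallP/(_ v)/forallP => H; apply/subsetP => y; rewrite !inE.
by have /andP[_ /implyP] := H y.
Qed.

(* The patterns at [v] extending a fixed orientation of [G - v] shatter only
   sets spanning no three disjoint edges: a shattered triple of disjoint edges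
   could be turned into triangles of any prescribed types. *)
Definition no3match G (A : {set V}) := forall a0 b0 a1 b1 a2 b2,
  uniq [:: a0; b0; a1; b1; a2; b2] -> {subset [:: a0; b0; a1; b1; a2; b2] <= A} ->
  G a0 b0 -> G a1 b1 -> G a2 b2 -> False.

Lemma shattered_no3match G v D0 A : symmetric G -> irreflexive G ->
  shatters [set out D v | D in [set D in Horients G | delD v D == D0]] A ->
  A \subset nbr G v /\ no3match G A.
Proof.
move=> symG irrG /shattersP sh; have sA : A \subset nbr G v.
  have [C /imsetP[D + ->] <-] := sh A (subxx A).
  rewrite !inE => /andP[/andP[oD _] _].
  by apply: subset_trans (subsetIl _ _) (out_sub_nbr _ oD).
split=> // a0 b0 a1 b1 a2 b2 U sub e0 e1 e2.
(* As [D0] fixes the direction of [ab], exactly one choice of the out-neighbour of [v] among [a] and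
   [b] yields a triangle of type [t]. *)
pose sel t a b := if D0 (a, b) == t then a else b.
pose B := [set sel t0 a0 b0; sel t1 a1 b1; sel t2 a2 b2].
have [i0 [j0 [i1 [j1 [i2 j2]]]]] : a0 \in A /\ b0 \in A /\ a1 \in A /\ b1 \in A /\
    a2 \in A /\ b2 \in A.
  by split; [|split; [|split; [|split; [|split]]]]; apply: sub; rewrite !inE eqxx ?orbT.
have sB : B \subset A.
  rewrite !subUset !sub1set /sel -andbA.
  by apply/and3P; split; case: ifP.
have [C /imsetP[D + ->] eqB] := sh B sB.
rewrite !inE => /andP[/andP[oD /HfreeP fD] /eqP eqD0].
have Dv y : y \in A -> D (v, y) = (y \in B) by move=> yA; rewrite -eqB !inE yA andbT.
have nv y : y \in A -> G v y by move/(subsetP sA); rewrite inE.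
have neqv y : y \in A -> y != v.
  by move=> /nv; apply: contraTneq => ->; rewrite irrG.
have DD0 x y : x \in A -> y \in A -> D (x, y) = D0 (x, y).
  by move=> /neqv xv /neqv yv; rewrite -eqD0 ffunE /= xv yv !andbT.
have U' : uniq [:: v; a0; b0; a1; b1; a2; b2].
  rewrite cons_uniq U andbT; apply/negP => /sub /neqv; by rewrite eqxx.
have [[m0 m1 m2] [m0' m1' m2']] := mem_choices (erefl B) U.
apply: (fD _ _ _ _ _ _ _ U'); rewrite (triE _ symG oD) ?nv // !Dv // DD0 //.
- by rewrite m0 m0'; case: (D0 _); case: (t0).
- by rewrite m1 m1'; case: (D0 _); case: (t1).
by rewrite m2 m2'; case: (D0 _); case: (t2).
Qed.
End Orientations.

(** * Counting orientations with local constraints *)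

Section Edges.
Variable V : finType.
Implicit Types (G : rel V) (x y u v : V).
Notation digraph := {ffun V * V -> bool}.
Implicit Types D : digraph.

Definition darts G := [set p : V * V | G p.1 p.2].
(** The order given by [enum_rank] selects one of the two darts of each edge. *)
Definition edges G := [set p : V * V | G p.1 p.2 && (enum_rank p.1 < enum_rank p.2)].

Lemma card_darts G : symmetric G -> irreflexive G -> #|darts G| = 2 * #|edges G|.
Proof.
move=> symG irrG; pose swap (p : V * V) := (p.2, p.1).
have inj : injective swap by move=> [x y] [x' y'] [-> ->].
rewrite mul2n -addnn -{2}(card_imset (edges G) inj).
rewrite -(cardsID (edges G)) (setIidPr _); last first.
  by apply/subsetP => p; rewrite !inE => /andP[].
congr (_ + _); apply: eq_card => -[x y]; rewrite !inE /=.
apply/idP/imsetP => [/andP[+ Gxy] | [[x' y']]].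
  rewrite Gxy -leqNgt leq_eqVlt => /orP[/eqP/val_inj/enum_rank_inj eqxy | lt].
    by rewrite eqxy irrG in Gxy.
  by exists (y, x); rewrite // inE /= symG Gxy.
rewrite inE /= => /andP[Gxy lt] [-> ->]; rewrite symG Gxy andbT /=.
by rewrite -leqNgt ltnW.
Qed.

Definition edge_code G D := [set p in edges G | D p].

Lemma edge_code_inj G : symmetric G -> irreflexive G ->
  {in [set D | orients G D] &, injective (edge_code G)}.
Proof.
move=> symG irrG D D'; rewrite !inE => oD oD' /setP eqE; apply/ffunP => -[x y].
have [Gxy | nG] := boolP (G x y); last by rewrite !(orients_nedge oD, orients_nedge oD').
have /(orientsP _ symG)[H _] := oD; have /(orientsP _ symG)[H' _] := oD'.
have [lt | lt | /val_inj/enum_rank_inj eqxy] := ltngtP (enum_rank x) (enum_rank y).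
- by have := eqE (x, y); rewrite !inE /= Gxy lt.
- have := eqE (y, x); rewrite !inE /= symG Gxy lt /= (H _ _ Gxy) (H' _ _ Gxy).
  by move/negb_inj.
by rewrite eqxy irrG in Gxy.
Qed.

Lemma card_orients G : symmetric G -> irreflexive G ->
  #|[set D | orients G D]| = 2 ^ #|edges G|.
Proof.
move=> symG irrG; rewrite -card_powerset; apply/eqP; rewrite eqn_leq; apply/andP; split.
  rewrite -(card_in_imset (edge_code_inj symG irrG)); apply: subset_leq_card.
  by apply/subsetP => _ /imsetP[D _ ->]; rewrite inE; apply/subsetP => p; rewrite inE => /andP[].
pose dec (A : {set V * V}) : digraph := [ffun p => G p.1 p.2 &&
  if enum_rank p.1 < enum_rank p.2 then p \in A else (p.2, p.1) \notin A].
have inj : {in powerset (edges G) &, injective dec}.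
  have decE A p : A \in powerset (edges G) -> (p \in A) = (p \in edges G) && dec A p.
    rewrite powersetE => /subsetP sA; rewrite ffunE inE; have := sA p; rewrite inE.
    by case: (p \in A) => [/(_ isT)/andP[-> ->] // | _]; case: (G _ _) => //=; case: (_ < _).
  by move=> A A' pA pA' eqd; apply/setP => p; rewrite (decE A) // (decE A') // eqd.
rewrite -(card_in_imset inj); apply: subset_leq_card; apply/subsetP => _ /imsetP[A _ ->].
rewrite inE; apply/(orientsP _ symG); split=> [x y Gxy | x y]; rewrite !ffunE /=; last by case/andP.
rewrite symG Gxy /=.
have [lt | lt | /val_inj/enum_rank_inj eqxy] := ltngtP (enum_rank x) (enum_rank y).
- by [].
- by rewrite negbK.
by rewrite eqxy irrG in Gxy.
Qed.

Variables (ys : seq V) (y0 : V) (es : seq (nat * nat)) (t : bool).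

(* [c], [m], [o] list the values [D (x, y)], [G x y] for [y] in [ys], and the
   orientations of the edges listed in [es]; [compatible] says that [x] spans no
   triangle of type [t] with any of these edges. *)
Definition compatible (m o c : seq bool) :=
  all2 implb c m &&
  all (fun p : nat * nat * bool =>
    nth false m p.1.1 && nth false m p.1.2 ==>
    ~~ ((nth false c p.1.2 != nth false c p.1.1) && (p.2 == (nth false c p.1.1 == t))))
    (zip es o).

Definition end_dirs D := [seq D (nth y0 ys p.1, nth y0 ys p.2) | p <- es].

Definition avoids G D x :=
  compatible [seq G x y | y <- ys] (end_dirs D) [seq D (x, y) | y <- ys].

Definition cut G (xs : seq V) : rel V := fun u v =>
  G u v && ~~ ((u \in xs) && (v \in ys) || (v \in xs) && (u \in ys)).

Lemma cut_sym G xs : symmetric G -> symmetric (cut G xs).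
Proof. by move=> symG u v; rewrite /cut symG orbC. Qed.
Lemma cut_irr G xs : irreflexive G -> irreflexive (cut G xs).
Proof. by move=> irrG u; rewrite /cut irrG. Qed.

Fixpoint bitseqs k : seq (seq bool) :=
  if k is k'.+1 then [seq true :: s | s <- bitseqs k'] ++ [seq false :: s | s <- bitseqs k']
  else [:: [::]].

Lemma mem_bitseqs s : s \in bitseqs (size s).
Proof.
elim: s => //= b s IH; rewrite mem_cat; case: b; apply/orP; [left|right]; exact: map_f.
Qed.

(* At most [bnd] patterns at a vertex are compatible, whatever edges are missing
   and however those in [es] are oriented. *)
Definition compatible_bound bnd :=
  all (fun m => all (fun o => count (compatible m o) (bitseqs (size ys)) <= bnd)
    (bitseqs (size es))) (bitseqs (size ys)).

(** Orient first all edges except those between [xs] and [ys]. This settles the directions of [es],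
    after which each vertex of [xs] has at most [bnd] patterns towards [ys]. The induction cuts off
    one vertex of [xs] at a time. *)
Lemma card_avoiding G xs bnd : symmetric G -> irreflexive G -> compatible_bound bnd ->
  all (fun p => (p.1 < size ys) && (p.2 < size ys)) es ->
  uniq xs -> {in xs, forall x, x \notin ys} ->
  #|[set D | orients G D && all (avoids G D) xs]| <= bnd ^ size xs * 2 ^ #|edges (cut G xs)|.
Proof.
move=> symG irrG /allP cb /allP ses; elim: xs G symG irrG => [|x xs IH] G symG irrG.
  move=> _ _; rewrite mul1n -card_orients; [| exact: cut_sym | exact: cut_irr].
  apply: subset_leq_card; apply/subsetP => D; rewrite !inE andbT => /forallP oD.
  apply/forallP => u; apply/forallP => v; rewrite /cut !in_nil andbT.
  by have /forallP := oD u; apply.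
move=> /andP[xxs Uxs] nys; have xys : x \notin ys by apply: nys; rewrite inE eqxx.
have nys' : {in xs, forall x', x' \notin ys}.
  by move=> z zxs; apply: nys; rewrite inE zxs orbT.
pose G1 := cut G [:: x].
have <- : #|edges (cut G1 xs)| = #|edges (cut G (x :: xs))|.
  apply: eq_card => -[u v]; rewrite !inE /= /G1 /cut !inE; case: (G u v) => //=.
  by case: (u == x); case: (v == x); case: (u \in ys); case: (v \in ys); rewrite ?andbF ?andbT ?orbT ?orbF.
rewrite expnS -mulnA (leq_trans _ (leq_mul (leqnn bnd) (IH G1 _ _ Uxs nys'))) //;
  [| exact: cut_sym | exact: cut_irr].
pose cutD D : digraph := [ffun p =>
  D p && ~~ ((p.1 == x) && (p.2 \in ys) || (p.2 == x) && (p.1 \in ys))].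
have ynx y : y \in ys -> (y == x) = false by move=> yys; apply: contraNF xys => /eqP<-.
apply: (card_le_fibers (f := cutD)).
  move=> D; rewrite !inE /= => /andP[oD /andP[_ /allP avD]]; apply/andP; split.
    apply/forallP => u; apply/forallP => v; have /forallP/(_ u)/forallP/(_ v) := oD.
    rewrite /G1 /cut !ffunE !inE /= (orbC ((v == x) && _)).
    by case: (_ || _); rewrite ?andbF ?andbT.
  apply/allP => z zxs; have := avD z zxs.
  have zx : (z == x) = false by apply: contraNF xxs => /eqP<-.
  have zys : (z \in ys) = false by apply/negbTE; apply: nys'.
  have D1 y : y \in ys -> cutD D (z, y) = D (z, y).
    by move=> yys; rewrite ffunE /= zx zys andbF andbT.
  have G1E y : y \in ys -> G1 z y = G z y.
    by move=> yys; rewrite /G1 /cut !inE zx zys andbF andbT.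
  rewrite /avoids; have -> : [seq G1 z y | y <- ys] = [seq G z y | y <- ys] by apply/eq_in_map.
  have -> : [seq cutD D (z, y) | y <- ys] = [seq D (z, y) | y <- ys] by apply/eq_in_map.
  have -> // : end_dirs (cutD D) = end_dirs D.
  apply/eq_in_map => p /ses/andP[p1 p2]; rewrite ffunE /=.
  by rewrite !ynx ?mem_nth //= andbT.
move=> D0; have [-> | [D1]] := set_0Vmem [set D in [set D | orients G D && all (avoids G D) (x :: xs)] | cutD D == D0].
  by rewrite cards0.
rewrite !inE /= => /andP[_ /eqP eD1].
pose code D := [tuple of [seq D (x, y) | y <- in_tuple ys]].
set F := [set D in _ | _].
have FP D : D \in F -> [/\ orients G D, avoids G D x & cutD D = D0].
  by rewrite !inE => /andP[/andP[-> /= /andP[->]] _ /eqP].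
have inj : {in F &, injective code}.
  move=> D D' /FP[oD _ eD] /FP[oD' _ eD'] /(congr1 val)/= /eq_in_map eqc.
  have [H _] := orientsP _ symG oD; have [H' _] := orientsP _ symG oD'.
  apply/ffunP => -[u v].
  have [uv | nuv] := boolP ((u == x) && (v \in ys)).
    by case/andP: uv => /eqP-> /eqc.
  have [vu | nvu] := boolP ((v == x) && (u \in ys)).
    case/andP: vu => /eqP-> uys; have [Gxu | nG] := boolP (G x u).
      by rewrite (H _ _ Gxu) (H' _ _ Gxu) eqc.
    by rewrite !(orients_nedge oD, orients_nedge oD') // symG.
  have /ffunP/(_ (u, v)) : cutD D = cutD D' by rewrite eD.
  by rewrite !ffunE /= (negPf nuv) (negPf nvu) !andbT.
rewrite -(card_in_imset inj).
(* No pair inside [ys] is cut, so one list [o] of directions serves the whole fibre, and its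
   patterns are all compatible with the same [m] and [o]. *)
pose m := [seq G x y | y <- ys]; pose o := end_dirs D1.
apply: leq_trans (_ : count (compatible m o) (bitseqs (size ys)) <= _); last first.
  have /cb/allP : m \in bitseqs (size ys) by rewrite -(size_map (G x) ys) mem_bitseqs.
  apply; rewrite /o /end_dirs -(size_map (fun p => D1 (nth y0 ys p.1, nth y0 ys p.2)) es).
  exact: mem_bitseqs.
rewrite cardE -(size_map val) -size_filter; apply: uniq_leq_size.
  by rewrite map_inj_uniq ?enum_uniq //; apply: val_inj.
move=> s /mapP[c]; rewrite mem_enum => /imsetP[D /FP[oD avD eD] ->] -> /=.
rewrite mem_filter -[X in bitseqs X](size_map (fun y => D (x, y))) mem_bitseqs andbT.
suff -> : o = end_dirs D by [].
apply/eq_in_map => p /ses/andP[p1 p2].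
have /ffunP/(_ (nth y0 ys p.1, nth y0 ys p.2)) : cutD D1 = cutD D by rewrite eD1.
by rewrite !ffunE /= !ynx ?mem_nth //= !andbT.
Qed.
End Edges.

(** * Graphs of maximal degree 2 without three disjoint edges *)

Lemma double_count (T : finType) (G : rel T) (P C : {set T}) : symmetric G ->
  \sum_(x in C) #|nbr G x :&: P| = \sum_(z in P) #|nbr G z :&: C|.
Proof.
move=> symG.
have E (B C' : {set T}) : \sum_(x in C') #|nbr G x :&: B| = \sum_(x in C') \sum_(z in B) G x z.
  apply: eq_bigr => x _; rewrite -sum1_card.
  rewrite (eq_bigl (fun z => (z \in B) && G x z)) => [|z]; last by rewrite !inE andbC.
  by rewrite big_mkcondr; apply: eq_bigr => z _; case: (G x z).
rewrite !E exchange_big; apply: eq_bigr => z _; apply: eq_bigr => x _.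
by rewrite symG.
Qed.

Lemma card_gt0_ex (T : finType) (A : {set T}) : 0 < #|A| -> exists x, x \in A.
Proof. by move/card_gt0P. Qed.

Section SmallGraph.
Variables (V : finType) (G : rel V) (A : {set V}).
Hypotheses (symG : symmetric G) (irrG : irreflexive G).
Hypothesis deg2 : forall x, x \in A -> #|nbr G x :&: A| <= 2.
Hypothesis no3 : no3match G A.
Notation N x := (nbr G x :&: A).
Notation dsum := (\sum_(x in A) #|N x|).
Notation D2 := [set x in A | #|N x| == 2].

Let neqG x y : G x y -> x != y.
Proof. by apply: contraTneq => ->; rewrite irrG. Qed.

Let mN x y : (y \in N x) = G x y && (y \in A).
Proof. by rewrite !inE. Qed.

Lemma exists_edge : 0 < dsum -> exists p q, [/\ p \in A, q \in A & G p q].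
Proof.
rewrite lt0n sum_nat_eq0 negb_forall => /existsP[x]; rewrite negb_imply => /andP[xA].
by rewrite cards_eq0 => /set0Pn[y]; rewrite mN => /andP[xy yA]; exists x, y.
Qed.

Definition has_config (ys : seq V) (es : seq (nat * nat)) :=
  [/\ uniq ys, {subset ys <= A} &
   forall y0 p, p \in es -> G (nth y0 ys p.1) (nth y0 ys p.2)].

Definition path2 := [:: (0, 1); (1, 2)].
Definition matching2 := [:: (0, 1); (2, 3)].
Definition path2_edge := [:: (0, 1); (1, 2); (3, 4)].
Definition cycle4 := [:: (0, 1); (1, 2); (2, 3); (3, 0)].

Lemma config1 : 0 < dsum -> exists ys, size ys = 2 /\ has_config ys [:: (0, 1)].
Proof.
case/exists_edge => p [q [pA qA pq]]; exists [:: p; q]; split=> //; split.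
- by rewrite /= inE neqG.
- by move=> z; rewrite !inE => /orP[]/eqP->.
by move=> y0 z; rewrite inE => /eqP->.
Qed.

(** There are at least two edges. A vertex of degree 2 is the middle of a path; if there is none,
    all edges are disjoint. *)
Lemma config2 : 4 <= dsum -> exists ys,
  size ys = 3 /\ has_config ys path2 \/ size ys = 4 /\ has_config ys matching2.
Proof.
move=> ge4; have [D2_0 | [x]] := set_0Vmem D2; last first.
  rewrite inE => /andP[xA /eqP/esym/eqP]; rewrite eq_sym => /cards2P[y [z [yz eqN]]].
  have : y \in N x by rewrite eqN !inE eqxx.
  have : z \in N x by rewrite eqN !inE eqxx orbT.
  rewrite !mN => /andP[xz zA] /andP[xy yA].
  exists [:: y; x; z]; left; split=> //; split.
  - by rewrite /= !inE negb_or yz (eq_sym y) !neqG.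
  - by move=> w; rewrite !inE => /or3P[]/eqP->.
  by move=> y0 w; rewrite !inE => /orP[]/eqP->; rewrite //= symG.
have le1 x : x \in A -> #|N x| <= 1.
  move=> xA; have := deg2 xA; rewrite leq_eqVlt => /orP[c2 | //].
  by have := in_set0 x; rewrite -D2_0 inE xA c2.
have [p [q [pA qA pq]]] := exists_edge (leq_trans (isT : 0 < 4) ge4).
have pnq := neqG pq.
have : 0 < \sum_(x in A :\ p :\ q) #|N x|.
  move: ge4; rewrite (big_setD1 p) //= (big_setD1 q) /= ?in_setD1 1?eq_sym ?pnq //.
  by have := le1 p pA; have := le1 q qA; lia.
rewrite lt0n sum_nat_eq0 negb_forall => /existsP[x]; rewrite negb_imply => /andP[].
rewrite !in_setD1 cards_eq0 => /and3P[xq xp xA] /set0Pn[y]; rewrite mN => /andP[xy yA].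
have only u v w : u \in A -> G u v -> G u w -> v \in A -> w \in A -> v = w.
  move=> uA uv uw vA wA; apply/eqP/negPn/negP => vw; have := le1 u uA.
  rewrite leqNgt (leq_trans _ (subset_leq_card (_ : [set v; w] \subset _))) //.
    by rewrite cards2 vw.
  by rewrite subUset !sub1set !mN uv uw vA.
have yp : y != p by apply: contraNneq xq => eqyp; rewrite (only p x q) // -eqyp symG.
have yq : y != q by apply: contraNneq xp => eqyq; rewrite (only q x p) // -?eqyq symG // eqyq.
exists [:: p; q; x; y]; right; split=> //; split.
- by rewrite /= !inE !negb_or pnq (eq_sym p x) xp (eq_sym q x) xq (eq_sym p y) yp (eq_sym q y) yq neqG.
- by move=> w; rewrite !inE => /or4P[]/eqP->.
by move=> y0 w; rewrite !inE => /orP[]/eqP->.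
Qed.

(** By the degree bound an edge meets at most two others, so among four edges one is disjoint from
    it. *)
Lemma exists_matching2 : 8 <= dsum -> exists p q p' q', [/\ uniq [:: p; q; p'; q'],
  {subset [:: p; q; p'; q'] <= A}, G p q & G p' q'].
Proof.
move=> ge8; have [p [q [pA qA pq]]] := exists_edge (leq_trans (isT : 0 < 8) ge8).
have pnq := neqG pq; pose Z := [set p; q].
have cN u v : u \in A -> v \in Z -> G u v -> #|nbr G u :&: (A :\: Z)| <= 1.
  move=> uA vZ uv; rewrite -ltnS; apply: leq_trans (deg2 uA); apply: proper_card.
  apply/properP; split; first by rewrite setIS // subsetDl.
  exists v; last by rewrite !in_setI in_setD vZ andbF.
  by rewrite mN uv; move: vZ; rewrite !inE => /orP[]/eqP->.
have sZ : \sum_(x in Z) #|nbr G x :&: (A :\: Z)| <= 2.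
  rewrite big_setU1 ?inE //= big_set1 (leq_add (n1 := 1) (n2 := 1)) //.
    by apply: (cN p q); rewrite ?inE ?eqxx ?orbT.
  by apply: (cN q p); rewrite ?inE ?eqxx ?orbT // symG.
have : 0 < \sum_(x in A :\: Z) #|nbr G x :&: (A :\: Z)|.
  have : dsum = \sum_(x in Z) #|N x| + \sum_(x in A :\: Z) #|N x|.
    rewrite (big_setID Z) /=; congr (_ + _); apply: eq_bigl => x; rewrite !inE.
    by case: eqP => [->|_]; rewrite ?pA //; case: eqP => [->|_]; rewrite ?qA ?andbF.
  have : \sum_(x in A :\: Z) #|N x| = \sum_(x in A :\: Z) #|nbr G x :&: Z| +
      \sum_(x in A :\: Z) #|nbr G x :&: (A :\: Z)|.
    rewrite -big_split /=; apply: eq_bigr => x _; rewrite -(cardsID Z).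
    congr (_ + _); apply: eq_card => y; rewrite !inE; last by case: (G x y); rewrite ?andbF.
    by case: (G x y) => //=; case: eqP => [->|_]; rewrite ?pA //; case: eqP => [->|_]; rewrite ?qA ?andbF.
  rewrite (double_count Z (A :\: Z) symG).
  have : \sum_(x in Z) #|N x| <= 4.
    by rewrite big_setU1 ?inE //= big_set1 (leq_add (n1 := 2) (n2 := 2)) // deg2.
  by move: sZ ge8; clear; lia.
rewrite lt0n sum_nat_eq0 negb_forall => /existsP[x]; rewrite negb_imply => /andP[].
rewrite cards_eq0 !inE negb_or -!andbA => /and3P[xp xq xA] /set0Pn[y].
rewrite !inE negb_or -!andbA => /and4P[xy yp yq yA].
exists p, q, x, y; split=> //.
  by rewrite /= !inE !negb_or pnq (eq_sym p x) xp (eq_sym q x) xq (eq_sym p y) yp (eq_sym q y) yq neqG.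
by move=> w; rewrite !inE => /or4P[]/eqP->.
Qed.

(* Every edge meets the maximal matching [pq, p'q'], and an outer neighbour of
   both [p] and [q] is unique: two of them would yield a third matching edge. *)
Section Matching2.
Variables (p q p' q' : V).
Hypotheses (U : uniq [:: p; q; p'; q']) (sA : {subset [:: p; q; p'; q'] <= A}).
Hypotheses (pq : G p q) (pq' : G p' q').
Let Z : {set V} := [set z in [:: p; q; p'; q']].
Notation outer z := #|nbr G z :&: (A :\: Z)|.

Let uneq : [/\ p != q, p != p' & p != q'] /\ [/\ q != p', q != q' & p' != q'].
Proof.
move: U; rewrite /= !inE !negb_or -!andbA => /and5P[-> -> -> ->].
by case/andP=> -> /andP[-> _].
Qed.

Let inA : [/\ p \in A, q \in A, p' \in A & q' \in A].
Proof. by split; apply: sA; rewrite !inE eqxx ?orbT. Qed.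

Lemma inner_edge x y : x \in A -> y \in A -> G x y -> (x \in Z) || (y \in Z).
Proof.
move=> xA yA xy; apply/negPn/negP; rewrite negb_or !inE !negb_or -!andbA.
case/and5P=> x1 x2 x3 x4 /and4P[y1 y2 y3 y4].
have [[u1 u2 u3] [u4 u5 u6]] := uneq; have [i1 i2 i3 i4] := inA.
apply: (no3 (a0 := p) (b0 := q) (a1 := p') (b1 := q') (a2 := x) (b2 := y)) => //.
  rewrite /= !inE !negb_or u1 u2 u3 u4 u5 u6 (neqG xy) /=.
  by rewrite !(eq_sym p) !(eq_sym q) !(eq_sym p') !(eq_sym q') x1 x2 x3 x4 y1 y2 y3 y4.
by move=> w; rewrite !inE => /orP[/eqP->|/orP[/eqP->|/orP[/eqP->|/orP[/eqP->|/orP[]/eqP->]]]].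
Qed.

(** Every edge meets [Z], so the degrees of the vertices outside [Z] can be counted from [Z]. *)
Lemma dsumE : dsum = \sum_(z in Z) (#|N z| + outer z).
Proof.
have sZA : Z \subset A.
  by apply/subsetP => z; rewrite !inE => zZ; apply: sA; rewrite !inE.
rewrite big_split /= (big_setID Z) /= (setIidPr sZA); congr (_ + _).
rewrite -(double_count Z (A :\: Z) symG); apply: eq_bigr => x; rewrite inE => /andP[xZ xA].
apply: eq_card => y; rewrite !in_setI inE; have [xy | //] := boolP (G x y).
apply/idP/idP => [yA | /(subsetP sZA) //].
by have := inner_edge xA yA xy; rewrite (negPf xZ).
Qed.

Lemma outer_lt z w : z \in Z -> w \in Z -> G z w -> outer z < #|N z|.
Proof.
move=> zZ wZ zw; apply: proper_card; apply/properP; split; first by rewrite setIS // subsetDl.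
exists w; last by rewrite in_setI in_setD wZ andbF.
by rewrite mN zw; apply: sA; move: wZ; rewrite !inE.
Qed.

Lemma shared_outer : outer p = 1 -> outer q = 1 ->
  exists u, [/\ u \in A, u \notin Z, G u p, G u q & #|N u| == 2].
Proof.
move=> op oq.
have [u] : exists u, u \in nbr G p :&: (A :\: Z) by apply: card_gt0_ex; rewrite op.
have [v] : exists v, v \in nbr G q :&: (A :\: Z) by apply: card_gt0_ex; rewrite oq.
rewrite !in_setI !in_setD ![_ \in nbr _ _]inE => /and3P[qv vZ vA] /and3P[pu uZ uA].
have [i1 i2 i3 i4] := inA; have [[u1 u2 u3] [u4 u5 u6]] := uneq.
have [eq_uv | nuv] := eqVneq u v; last first.
  exfalso; move: vZ uZ; rewrite !inE !negb_or => /and4P[v1 v2 v3 v4] /and4P[w1 w2 w3 w4].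
  apply: (no3 (a0 := p) (b0 := u) (a1 := q) (b1 := v) (a2 := p') (b2 := q')) => //.
    rewrite /= !inE !negb_or u1 u2 u3 u4 u5 u6 !(eq_sym p) !(eq_sym q) w1 w2 w3 w4 v1 v2 v3 v4 nuv.
    by [].
  by move=> w; rewrite !inE => /orP[/eqP->|/orP[/eqP->|/orP[/eqP->|/orP[/eqP->|/orP[]/eqP->]]]].
exists u; split=> //; rewrite 1?symG // ?eq_uv // eqn_leq deg2 -?eq_uv //=.
apply: leq_trans (subset_leq_card (_ : [set p; q] \subset _)); first by rewrite cards2 u1.
by rewrite subUset !sub1set !mN i1 i2 !(symG u) pu eq_uv qv.
Qed.
End Matching2.

(** Each of the four matched vertices contributes 1, 2 or 3 to the sum in [dsumE], and more than 1
    only if its degree is 2, so a large sum forces degree 2 on many of them. If both ends of a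
    matching edge contribute 3, their shared outer neighbour has degree 2 as well. *)
Lemma card_deg2 : [/\ dsum <= 12, 8 <= dsum -> 2 <= #|D2|, 10 <= dsum -> 4 <= #|D2| &
  12 <= dsum -> 6 <= #|D2|].
Proof.
have [ge8 | lt8] := leqP 8 dsum; last by split; move: lt8; clear; lia.
have [p [q [p' [q' [U sA pq pq']]]]] := exists_matching2 ge8.
have := dsumE U sA pq pq'.
have U' : uniq [:: p'; q'; p; q] by rewrite -(rot_uniq 2).
have sA' : {subset [:: p'; q'; p; q] <= A}.
  by move=> z; rewrite !inE => zZ; apply: sA; rewrite !inE orbA orbC -!orbA.
have sh := shared_outer U sA pq'; have sh' := shared_outer U' sA' pq.
set Z : {set V} := [set z in [:: p; q; p'; q']] in sh *.
have eqZ : [set z in [:: p'; q'; p; q]] = Z.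
  by apply/setP => z; rewrite !inE orbA orbC -!orbA.
rewrite {}eqZ in sh'.
have [iA jA iA' jA'] : [/\ p \in A, q \in A, p' \in A & q' \in A].
  by split; apply: sA; rewrite !inE eqxx ?orbT.
have o1 := @outer_lt p q p' q' sA p q; have o2 := @outer_lt p q p' q' sA q p.
have o3 := @outer_lt p q p' q' sA p' q'; have o4 := @outer_lt p q p' q' sA q' p'.
rewrite -/Z !inE !eqxx ?orbT in o1 o2 o3 o4.
have {}o1 := o1 isT isT pq; have {}o3 := o3 isT isT pq'.
have {}o2 : #|nbr G q :&: (A :\: Z)| < #|N q| by apply: o2; rewrite // symG.
have {}o4 : #|nbr G q' :&: (A :\: Z)| < #|N q'| by apply: o4; rewrite // symG.
have := (deg2 iA, deg2 jA, deg2 iA', deg2 jA') => -[[[d1 d2] d3] d4].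
have sumZ (F : V -> nat) : \sum_(z in Z) F z = F p + (F q + (F p' + F q')).
  rewrite (eq_bigl (mem [:: p; q; p'; q'])) => [|z]; last by rewrite !inE.
  by rewrite -big_uniq // !big_cons big_nil /= addn0.
have inZ : [/\ p \in Z, q \in Z, p' \in Z & q' \in Z] by rewrite !inE !eqxx ?orbT.
have cZ : #|D2 :&: Z| = (#|N p| == 2) + ((#|N q| == 2) + ((#|N p'| == 2) + (#|N q'| == 2))).
  rewrite -(sumZ (fun z => nat_of_bool (#|N z| == 2))).
  rewrite -sum1_card (eq_bigl (fun z => (z \in Z) && (#|N z| == 2))) => [|z].
    by rewrite big_mkcondr; apply: eq_bigr => z _; case: (_ == _).
  rewrite in_setI inE andbC; have [zZ | //] := boolP (z \in Z).
  by rewrite (sA _) //; rewrite inE in zZ.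
have cO : ((#|nbr G p :&: (A :\: Z)| == 1) && (#|nbr G q :&: (A :\: Z)| == 1)) +
    ((#|nbr G p' :&: (A :\: Z)| == 1) && (#|nbr G q' :&: (A :\: Z)| == 1)) <= #|D2 :\: Z|.
  have inO u : u \in A -> u \notin Z -> #|N u| == 2 -> u \in D2 :\: Z.
    by move=> uA uZ u2; rewrite in_setD uZ inE uA.
  have ge1 u : u \in A -> u \notin Z -> #|N u| == 2 -> 1 <= #|D2 :\: Z|.
    by move=> uA uZ u2; rewrite card_gt0; apply/set0Pn; exists u; apply: inO.
  have [/andP[/eqP e1 /eqP e2] | _] := boolP (_ && _).
    have [u [uA uZ up uq u2]] := sh e1 e2.
    have [/andP[/eqP e3 /eqP e4] | _] := boolP (_ && _); last by apply: ge1 uA uZ u2.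
    have [v [vA vZ vp vq v2]] := sh' e3 e4.
    (* A vertex shared by both matching edges would have four neighbours. *)
    have uv : u != v.
      apply: contraTneq (deg2 uA) => eq_uv; rewrite -ltnNge.
      apply: (@leq_trans (size [:: p; q; p'; q'])) => //.
      rewrite -(card_uniqP U); apply: subset_leq_card; apply/subsetP => z zZ.
      rewrite mN sA // andbT; move: zZ; rewrite !inE.
      by case/or4P=> /eqP->; rewrite // eq_uv.
    apply: (@leq_trans #|[set u; v]|); first by rewrite cards2 uv.
    apply: subset_leq_card.
    by rewrite subUset !sub1set !inO.
  have [/andP[/eqP e3 /eqP e4] | _] := boolP (_ && _); last by [].
  by have [v [vA vZ vp vq v2]] := sh' e3 e4; apply: ge1 vA vZ v2.
rewrite sumZ => eqd; rewrite eqd in ge8 *; have := cardsID Z D2; rewrite cZ => <-.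
move: o1 o2 o3 o4 d1 d2 d3 d4 cO ge8; clear.
move: #|_ :\: _| => r.
move: #|N p| #|N q| #|N p'| #|N q'| => n1 n2 n3 n4.
move: #|_| #|_| #|_| #|_| => m1 m2 m3 m4.
have cases n m : m < n -> n <= 2 -> [\/ n = 1 /\ m = 0, n = 2 /\ m = 0 | n = 2 /\ m = 1].
  by case: n m => [|[|[|n]]] [|[|m]] //; [constructor 1 | constructor 2 | constructor 3].
move=> l1 l2 l3 l4 d1 d2 d3 d4.
by case: (cases _ _ l1 d1) => -[-> ->]; case: (cases _ _ l2 d2) => -[-> ->];
   case: (cases _ _ l3 d3) => -[-> ->]; case: (cases _ _ l4 d4) => -[-> ->];
   rewrite ?addn0 ?add0n //= => ler _; split=> //; rewrite ?ltnS //; clear -ler; lia.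
Qed.
Lemma path2_edge_config u p q p' q' : uniq [:: p; q; p'; q'] ->
  {subset [:: p; q; p'; q'] <= A} -> G p q -> G p' q' ->
  u \in A -> u \notin [:: p; q; p'; q'] -> G p u ->
  has_config [:: u; p; q; p'; q'] path2_edge.
Proof.
move=> U sA pq pq' uA uZ pu; split; first by rewrite cons_uniq uZ.
  by move=> z; rewrite in_cons => /orP[/eqP-> // | /sA].
by move=> y0 w; rewrite !inE => /or3P[]/eqP->; rewrite //= symG.
Qed.

(** An edge leaving the four matched vertices extends one matching edge to a path disjoint from the
    other. If there is none, all matched vertices have degree 2 among themselves and form a
    4-cycle. *)
Lemma config4 : 8 <= dsum -> exists ys,
  size ys = 5 /\ has_config ys path2_edge \/ size ys = 4 /\ has_config ys cycle4.
Proof.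
move=> ge8; have [p [q [p' [q' [U sA pq pq']]]]] := exists_matching2 ge8.
have qp : G q p by rewrite symG.
have qp' : G q' p' by rewrite symG.
set Z : {set V} := [set z in [:: p; q; p'; q']].
have [iA jA iA' jA'] : [/\ p \in A, q \in A, p' \in A & q' \in A].
  by split; apply: sA; rewrite !inE eqxx ?orbT.
have [[z [u [zZ uA uZ zu]]] | none] :
    (exists z u, [/\ z \in Z, u \in A, u \notin Z & G z u]) \/
    (forall z u, z \in Z -> u \in A -> G z u -> u \in Z).
  have [/existsP[z /existsP[u /and4P[? ? ? ?]]] | H] :=
      boolP [exists z, exists u, [&& z \in Z, u \in A, u \notin Z & G z u]].
    by left; exists z, u.
  right=> z u zZ uA zu; apply: contraNT H => uZ.
  by apply/existsP; exists z; apply/existsP; exists u; apply/and4P.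
  have perm (s : seq V) : perm_eq [:: p; q; p'; q'] s ->
      [/\ uniq s, {subset s <= A} & u \notin s].
    move=> eqs; split; first by rewrite -(perm_uniq eqs).
      by move=> w; rewrite -(perm_mem eqs); apply: sA.
    by rewrite -(perm_mem eqs); apply: contra uZ => u4; rewrite in_set.
  move: zZ zu; rewrite !inE => /or4P[]/eqP-> zu.
  - have [] := perm [:: p; q; p'; q'] (perm_refl _) => *.
    by exists [:: u; p; q; p'; q']; left; split=> //; apply: path2_edge_config.
  - have [] := perm [:: q; p; p'; q'] => [|*]; first by rewrite (perm_catCA [:: p] [:: q] [:: p'; q']).
    by exists [:: u; q; p; p'; q']; left; split=> //; apply: path2_edge_config.
  - have [] := perm [:: p'; q'; p; q] => [|*]; first by rewrite (perm_catC [:: p; q] [:: p'; q']).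
    by exists [:: u; p'; q'; p; q]; left; split=> //; apply: path2_edge_config.
  have [] := perm [:: q'; p'; p; q] => [|*].
    apply: (@perm_trans _ [:: p'; q'; p; q]).
      by rewrite (perm_catC [:: p; q] [:: p'; q']).
    by rewrite (perm_catCA [:: p'] [:: q'] [:: p; q]).
  by exists [:: u; q'; p'; p; q]; left; split=> //; apply: path2_edge_config.
have NZ z : z \in Z -> #|nbr G z :&: (A :\: Z)| = 0.
  move=> zZ; apply/eqP; rewrite cards_eq0; apply/eqP/setP => u; rewrite in_setI in_setD in_set0 inE.
  by apply/negP => /and3P[zu uZ uA]; rewrite (none z u) in uZ.
have n2 z : z \in Z -> #|N z| = 2.
  move=> zZ; apply/eqP; rewrite eqn_leq deg2 ?(sA z) //=; last by rewrite inE in zZ.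
  rewrite leqNgt; apply/negP => lt2; move: ge8; rewrite (dsumE U sA pq pq') leqNgt => /negP; apply.
  rewrite -/Z (big_setD1 z) //= NZ // addn0.
  apply: (@leq_ltn_trans (1 + 2 * 3)) => //; apply: leq_add => //.
  have c3 : #|Z :\ z| = 3.
    have : #|Z| = 4 by rewrite cardsE (card_uniqP U).
    by rewrite (cardsD1 z) zZ => -[].
  rewrite -c3 mulnC -sum_nat_const leq_sum // => w; rewrite in_setD1 => /andP[_ wZ].
  by rewrite NZ // addn0 deg2 // sA //; rewrite inE in wZ.
have other z w : z \in Z -> exists y, [/\ y \in Z, y != w, y \in A & G z y].
  move=> zZ; have [y] : exists y, y \in N z :\ w.
    by apply: card_gt0_ex; have := n2 z zZ; rewrite (cardsD1 w); case: (_ \in _); clear; lia.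
  rewrite in_setD1 mN => /and3P[yw zy yA]; exists y; split=> //; exact: none zy.
have [pZ qZ pZ' qZ'] : [/\ p \in Z, q \in Z, p' \in Z & q' \in Z] by rewrite !inE !eqxx ?orbT.
have [y [yZ yq yA py]] := other p q pZ.
have [y' [yZ' yp' yA' qy']] := other q p qZ.
have yp : y != p by rewrite eq_sym neqG.
have yq' : y' != q by rewrite eq_sym neqG.
have mate z : z \in [:: p'; q'] -> exists w, [/\ w \in [:: p'; q'], w != z & G z w].
  have pnq := neqG pq'.
  by rewrite !inE => /orP[]/eqP->; [exists q' | exists p']; rewrite ?inE ?eqxx ?orbT // eq_sym.
have in2 z : z \in Z -> z != p -> z != q -> z \in [:: p'; q'].
  by rewrite !inE => + /negPf zp /negPf zq; rewrite zp zq.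
have y2 := in2 y yZ yp yq; have y2' := in2 y' yZ' yp' yq'.
have pq2 : (p \notin [:: p'; q']) /\ (q \notin [:: p'; q']).
  move: U; rewrite /= !inE !negb_or => /and4P[/and3P[_ a b] /andP[c d] _ _].
  by rewrite a b c d.
have nyy : y != y'.
  apply/negP => /eqP eqyy; have [w [w2 wy yw]] := mate y y2.
  have wA : w \in A by apply: sA; move: w2; rewrite !inE => /orP[] ->; rewrite ?orbT.
  have := deg2 yA; rewrite leqNgt => /negP; apply.
  apply: (@leq_trans (size [:: p; q; w])) => //.
  have Uw : uniq [:: p; q; w].
    rewrite /= !inE !negb_or (neqG pq) /= andbT; apply/andP; split.
      by apply: contraTneq w2 => <-; case: pq2.
    by apply: contraTneq w2 => <-; case: pq2.
  rewrite -(card_uniqP Uw); apply: subset_leq_card; apply/subsetP => z.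
  by rewrite mN !inE => /or3P[]/eqP->; rewrite ?iA ?jA ?wA ?yw // symG ?py // eqyy qy'.
have yy : G y' y.
  by move: y2 y2' nyy; rewrite !inE => /orP[]/eqP-> /orP[]/eqP->; rewrite ?eqxx.
exists [:: p; q; y'; y]; right; split=> //; split.
- rewrite /= !inE !negb_or (neqG pq) (eq_sym p y') yp' (eq_sym p y) yp (eq_sym q y') yq'.
  by rewrite (eq_sym q y) yq eq_sym nyy.
- by move=> w; rewrite !inE => /or4P[]/eqP->.
by move=> y0 w; rewrite !inE => /or4P[]/eqP->; rewrite //= symG.
Qed.
End SmallGraph.

(** * Nearly bipartite graphs with edges inside both parts *)

(** An edge of the configuration with both ends adjacent to [x] forbids one of the four patterns on
    its ends. The bounds 3, 5, 9, 15, 7 of this and the next lemmas are the numbers of independent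
    sets of the configurations. *)
Lemma bound_edge (V : finType) (ys : seq V) t : size ys = 2 ->
  compatible_bound ys [:: (0, 1)] t 3.
Proof. by move=> E; rewrite /compatible_bound E; case: t; vm_compute. Qed.
Lemma bound_path2 (V : finType) (ys : seq V) t : size ys = 3 ->
  compatible_bound ys path2 t 5.
Proof. by move=> E; rewrite /compatible_bound E; case: t; vm_compute. Qed.
Lemma bound_matching2 (V : finType) (ys : seq V) t : size ys = 4 ->
  compatible_bound ys matching2 t 9.
Proof. by move=> E; rewrite /compatible_bound E; case: t; vm_compute. Qed.
Lemma bound_path2_edge (V : finType) (ys : seq V) t : size ys = 5 ->
  compatible_bound ys path2_edge t 15.
Proof. by move=> E; rewrite /compatible_bound E; case: t; vm_compute. Qed.
Lemma bound_cycle4 (V : finType) (ys : seq V) t : size ys = 4 ->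
  compatible_bound ys cycle4 t 7.
Proof. by move=> E; rewrite /compatible_bound E; case: t; vm_compute. Qed.

Section Mixed.
Variables (V : finType) (G : rel V) (A B : {set V}).
Hypotheses (symG : symmetric G) (irrG : irreflexive G) (dAB : [disjoint A & B]).
Hypothesis suppG : forall x y, G x y -> x \in A :|: B.
Notation dsum C := (\sum_(x in C) #|nbr G x :&: C|).
Notation D2 C := [set x in C | #|nbr G x :&: C| == 2].

Lemma card_inner_darts (C : {set V}) :
  #|[set p : V * V | [&& G p.1 p.2, p.1 \in C & p.2 \in C]]| = dsum C.
Proof.
rewrite -sum1_card (eq_bigl (fun p : V * V => (p.1 \in C) && (G p.1 p.2 && (p.2 \in C)))).
  rewrite -(pair_big_dep (fun x => x \in C) (fun x y => G x y && (y \in C)) (fun _ _ => 1)).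
  by apply: eq_bigr => x _; rewrite -sum1_card; apply: eq_bigl => y; rewrite !inE.
by move=> p; rewrite inE; case: (G _ _) => //=; rewrite andbF.
Qed.

Lemma dsum_even (C : {set V}) : exists a, dsum C = 2 * a.
Proof.
pose GC : rel V := fun x y => [&& G x y, x \in C & y \in C].
exists #|edges GC|; rewrite -card_darts ?card_inner_darts // => [x y | x]; rewrite /GC.
  by rewrite symG (andbC (x \in C)).
by rewrite irrG.
Qed.

(** Counted in darts: those inside [A], those inside [B], and two for each pair in [A] times [B]
    that is not cut. *)
Lemma edges_cut_le (xs ys : seq V) : uniq xs -> uniq ys -> {subset xs <= A} -> {subset ys <= B} ->
  2 * #|edges (cut ys G xs)| + 2 * (size xs * size ys) <= dsum A + dsum B + 2 * (#|A| * #|B|).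
Proof.
move=> Ux Uy sxA syB; rewrite -card_darts; [| exact: cut_sym | exact: cut_irr].
pose XY := setX [set x in xs] [set y in ys].
have cXY : #|XY| = size xs * size ys.
  by rewrite cardsX !cardsE (card_uniqP Ux) (card_uniqP Uy).
have sXY : XY \subset setX A B.
  by apply/subsetP => -[x y]; rewrite !inE /= => /andP[/sxA-> /syB->].
pose R := setX A B :\: XY.
have cR : #|R| + size xs * size ys = #|A| * #|B|.
  by rewrite -cXY -cardsX -(cardsID XY (setX A B)) (setIidPr sXY) addnC.
pose swap (p : V * V) := (p.2, p.1).
have swapK : involutive swap by case.
pose DC (C : {set V}) := [set p : V * V | [&& G p.1 p.2, p.1 \in C & p.2 \in C]].
have : #|darts (cut ys G xs)| <= #|DC A :|: DC B :|: (R :|: swap @: R)|.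
  apply: subset_leq_card; apply/subsetP => -[x y]; rewrite !inE /= => /andP[xy].
  have := suppG xy; have : y \in A :|: B by apply: (@suppG y x); rewrite symG.
  have mem_swap : ((x, y) \in swap @: R) = ((y, x) \in R).
    by rewrite -[(x, y)]/(swap (y, x)) mem_imset //; apply: can_inj swapK.
  rewrite mem_swap !inE /= xy => yAB xAB; rewrite negb_or => /andP[n1 n2].
  case/orP: xAB => [xA|xB]; case/orP: yAB => [yA|yB]; rewrite ?xA ?xB ?yA ?yB ?orbT //= ?n1 ?n2 ?orbT //.
have := leq_card_setU (DC A) (DC B); have := leq_card_setU R (swap @: R).
have := leq_card_setU (DC A :|: DC B) (R :|: swap @: R).
rewrite (card_imset _ (can_inj swapK)) (card_inner_darts A) (card_inner_darts B).
move=> [l1 _] [l2 _] [l3 _]; move: l1 l2 l3 cR; clear; lia.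
Qed.

Variables (t : bool) (P : {set {ffun V * V -> bool}}).
Hypothesis oP : forall D, D \in P -> orients G D.
Hypothesis triP : forall D x y y', D \in P -> x \in D2 A -> y \in B -> y' \in B ->
  G x y -> G x y' -> G y y' -> ~~ tri t D x y y'.

(** The [a + b] inner edges may gain a factor [2 ^ (a + b)], while the constraints lose
    [bnd / 2 ^ size ys] at each vertex of [xs]; the numerical hypothesis compares the two. The
    factor 63/64 leaves room for the negligible orientations discarded in [mixed_le]. *)
Lemma card_config ys es bnd xs a b : has_config G B ys es ->
  all (fun p => (p.1 < size ys) && (p.2 < size ys)) es -> compatible_bound ys es t bnd ->
  0 < size xs -> uniq xs -> {subset xs <= D2 A} -> dsum A = 2 * a -> dsum B = 2 * b ->
  bnd ^ size xs * 2 ^ (a + b) <= 63 * 2 ^ (size xs * size ys) ->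
  64 * #|P| <= 63 * 2 ^ (#|A| * #|B| + 6).
Proof.
move=> [Uy sy Ges] /[dup] ses /allP ses' cb xs_gt0 Ux sx ea eb num.
have sxA : {subset xs <= A} by move=> x /sx; rewrite inE => /andP[].
have nys : {in xs, forall x, x \notin ys}.
  by move=> x /sxA xA; apply/negP => /sy; rewrite (disjointFr dAB xA).
have ltE := edges_cut_le Ux Uy sxA sy; rewrite ea eb in ltE.
have [y0 _] : exists x, x \in xs by case: (xs) xs_gt0 => // x ? _; exists x; apply: mem_head.
have le : #|P| <= bnd ^ size xs * 2 ^ #|edges (cut ys G xs)|.
  apply: leq_trans (card_avoiding y0 symG irrG cb ses Ux nys).
  apply: subset_leq_card; apply/subsetP => D PD; rewrite inE oP //=.
  apply/allP => x xxs; rewrite /avoids /compatible; apply/andP; split.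
    have /forallP/(_ x)/forallP o := oP PD.
    elim: (ys) => //= y s ->; rewrite andbT.
    by have /andP[_] := o y.
  rewrite /end_dirs; elim: (es) ses' Ges => //= p es' IH ses' Ges.
  rewrite IH ?andbT; last 2 first.
  - by move=> q qes; apply: ses'; rewrite inE qes orbT.
  - by move=> y q qes; apply: Ges; rewrite inE qes orbT.
  have /andP[p1 p2] := ses' p (mem_head _ _); have Gp := Ges y0 p (mem_head _ _).
  rewrite !(nth_map y0) //; apply/implyP => /andP[G1 G2].
  rewrite -(triE t symG (oP PD)) //.
  by apply: triP => //; [apply: sx | apply: sy; apply: mem_nth | apply: sy; apply: mem_nth].
rewrite -(leq_pmul2r (_ : 0 < 2 ^ (size xs * size ys))) ?expn_gt0 //.
apply: (@leq_trans (64 * (bnd ^ size xs * 2 ^ (a + b)) * 2 ^ (#|A| * #|B|))).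
  apply: (@leq_trans (64 * (bnd ^ size xs * 2 ^ #|edges (cut ys G xs)|) * 2 ^ (size xs * size ys))).
    by rewrite leq_mul2r leq_mul2l le !orbT.
  rewrite -!mulnA -!expnD !leq_mul2l leq_exp2l //.
  by rewrite -(leq_pmul2l (isT : 0 < 2)) !mulnDr ltE !orbT.
rewrite (expnD 2 (_ * _) 6).
apply: (@leq_trans (64 * (63 * 2 ^ (size xs * size ys)) * 2 ^ (#|A| * #|B|))).
  by rewrite leq_mul2r leq_mul2l num !orbT.
by move: (2 ^ (size xs * size ys)) (2 ^ (#|A| * #|B|)); clear; nia.
Qed.

Hypothesis degA : forall x, x \in A -> #|nbr G x :&: A| <= 2.
Hypothesis degB : forall x, x \in B -> #|nbr G x :&: B| <= 2.
Hypotheses (no3A : no3match G A) (no3B : no3match G B).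

(** The hypotheses force [a] to be 4, 5 or 6, and then [A] has 2, 4 or 6 vertices of degree 2 by
    [card_deg2]. The value of [b] determines the configuration found in [B], and arithmetic remains.
    The tightest case is [a = b = 4] with [path2_edge], where [15 ^ 2 * 2 ^ 8 <= 63 * 2 ^ 10]. *)
Lemma card_mixed a b : dsum A = 2 * a -> dsum B = 2 * b -> b <= a -> 0 < b -> 7 <= a + b ->
  64 * #|P| <= 63 * 2 ^ (#|A| * #|B| + 6).
Proof.
move=> ea eb ba b0 ab; have [a12 r2 r4 r6] := card_deg2 symG irrG degA no3A.
rewrite ea in a12 r2 r4 r6.
have pick r : 0 < r -> r <= #|D2 A| ->
    exists xs, [/\ size xs = r, uniq xs, 0 < size xs & {subset xs <= D2 A}].
  move=> r_gt0 ler; exists (take r (enum (D2 A))).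
  have sz : size (take r (enum (D2 A))) = r by rewrite size_takel // -cardE.
  by split; rewrite ?sz ?take_uniq ?enum_uniq // => x /mem_take; rewrite mem_enum.
have main r : 0 < r -> r <= #|D2 A| ->
    (b = 1 -> 3 ^ r * 2 ^ (a + b) <= 63 * 2 ^ (r * 2)) ->
    (2 <= b <= 3 -> 5 ^ r * 2 ^ (a + b) <= 63 * 2 ^ (r * 3) /\
                    9 ^ r * 2 ^ (a + b) <= 63 * 2 ^ (r * 4)) ->
    (4 <= b -> 15 ^ r * 2 ^ (a + b) <= 63 * 2 ^ (r * 5) /\
               7 ^ r * 2 ^ (a + b) <= 63 * 2 ^ (r * 4)) ->
    64 * #|P| <= 63 * 2 ^ (#|A| * #|B| + 6).
  move=> r_gt0 ler n1 n2 n4; have [xs [sxs Uxs xs0 sx]] := pick r r_gt0 ler.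
  have [b4 | b4] := leqP 4 b.
    have [n5 n4'] := n4 b4.
    have [|ys [[sys cfg] | [sys cfg]]] := config4 symG irrG degB no3B; first by rewrite eb; lia.
      by apply: (card_config cfg _ (bound_path2_edge t sys) xs0 Uxs sx ea eb); rewrite sys ?sxs.
    by apply: (card_config cfg _ (bound_cycle4 t sys) xs0 Uxs sx ea eb); rewrite sys ?sxs.
  have [b2 | b2] := leqP 2 b.
    have [|n3 n4'] := n2; first by rewrite b2 -ltnS b4.
    have [|ys [[sys cfg] | [sys cfg]]] := config2 symG irrG degB; first by rewrite eb; lia.
      by apply: (card_config cfg _ (bound_path2 t sys) xs0 Uxs sx ea eb); rewrite sys ?sxs.
    by apply: (card_config cfg _ (bound_matching2 t sys) xs0 Uxs sx ea eb); rewrite sys ?sxs.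
  have b1 : b = 1 by lia.
  have [|ys [sys cfg]] := config1 irrG (A := B); first by rewrite eb; lia.
  by apply: (card_config cfg _ (bound_edge t sys) xs0 Uxs sx ea eb); rewrite sys ?sxs // n1.
have le2 k : a + b <= k -> 2 ^ (a + b) <= 2 ^ k by rewrite leq_exp2l.
have [a6 | a6] := leqP 6 a.
  have a6' : a = 6 by lia.
  apply: (main 6) => // [|b1|b3|b4]; first by apply: r6; lia.
  - have := le2 7 ltac:(lia); lia.
  - have := le2 9 ltac:(lia); lia.
  have := le2 12 ltac:(lia); lia.
have [a5 | a5] := leqP 5 a.
  have a5' : a = 5 by lia.
  apply: (main 4) => // [|b1|b3|b4]; first by apply: r4; lia.
  - lia.
  - have := le2 8 ltac:(lia); lia.
  have := le2 10 ltac:(lia); lia.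
apply: (main 2) => // [|b1|b3|b4]; first by apply: r2; lia.
- lia.
- have := le2 7 ltac:(lia); lia.
have := le2 8 ltac:(lia); lia.
Qed.
End Mixed.

(** * Graphs without gain *)

Lemma leq_expl a b k : a <= b -> a ^ k <= b ^ k.
Proof. by case: k => // k ab; rewrite leq_exp2r. Qed.

Lemma not_indep (T : finType) (G : rel T) (A : {set T}) :
  ~~ indep G A -> exists x y, [/\ x \in A, y \in A & G x y].
Proof.
move/forall_inPn => [x xA /forall_inPn[y yA /negPn Gxy]].
by exists x, y.
Qed.

(** A maximal matching has at most two edges, and its endpoints meet every edge. *)
Lemma no3match_cover (T : finType) (G : rel T) (A : {set T}) :
  irreflexive G -> no3match G A ->
  exists R : {set T}, [/\ R \subset A, #|R| <= 4 & indep G (A :\: R)].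
Proof.
move=> irrG no3; have neqG x y : G x y -> x != y.
  by apply: contraTneq => ->; rewrite irrG.
have [iA | /not_indep[a0 [b0 [a0A b0A e0]]]] := boolP (indep G A).
  by exists set0; rewrite sub0set cards0 setD0.
have sub2 (x y : T) : x \in A -> y \in A -> [set x; y] \subset A.
  by move=> xA yA; rewrite subUset !sub1set xA.
have [i1 | /not_indep[a1 [b1]]] := boolP (indep G (A :\: [set a0; b0])).
  exists [set a0; b0]; split=> //; first exact: sub2.
  by rewrite cards2; case: (_ != _).
rewrite !inE !negb_or -!andbA => -[/and3P[a10 a1b0 a1A] /and3P[b10 b1b0 b1A] e1].
exists ([set a0; b0] :|: [set a1; b1]); split.
- by rewrite subUset !sub2.
- by rewrite (leq_trans (leq_card_setU _ _)) // !cards2; case: (_ != _); case: (_ != _).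
apply/negPn/negP => /not_indep[a2 [b2]].
rewrite !inE !negb_or -!andbA => -[/and5P[n1 n2 n3 n4 a2A] /and5P[m1 m2 m3 m4 b2A] e2].
apply: (no3 a0 b0 a1 b1 a2 b2) => //.
  have [h0 [h1 h2]] := (neqG _ _ e0, (neqG _ _ e1, neqG _ _ e2)).
  rewrite /= !inE !negb_or -!andbA.
  by do ?[apply/andP; split]; rewrite // eq_sym.
by move=> z; rewrite !inE => /orP[/eqP->|/orP[/eqP->|/orP[/eqP->|/orP[/eqP->|/orP[/eqP->|/eqP->]]]]].
Qed.

(** [U] is determined by the at most [k] elements of [Z] on the side [dir] and by its trace outside
    [Z]. *)
Lemma card_patterns (T : finType) (N Z : {set T}) k dir : Z \subset N ->
  #|[set U : {set T} | (U \subset N) && (#|[set b in Z | (b \in U) == dir]| <= k)]|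
  <= #|Z|.+1 ^ k * 2 ^ (#|N| - #|Z|).
Proof.
move=> sZN; pose f (U : {set T}) := ([set b in Z | (b \in U) == dir], U :\: Z).
have inj : injective f.
  move=> U U' [/setP eq1 /setP eq2]; apply/setP => b.
  have := eq1 b; have := eq2 b; rewrite !inE; case: (b \in Z) => //=.
  by case: (b \in U); case: (b \in U'); case: (dir).
rewrite -(card_imset _ inj).
pose R := setX [set W : {set T} | (W \subset Z) && (#|W| <= k)] (powerset (N :\: Z)).
apply: (@leq_trans #|R|).
  apply: subset_leq_card; apply/subsetP => _ /imsetP[U + ->].
  rewrite !inE /= => /andP[sUN ->]; rewrite andbT setSD // andbT.
  by apply/subsetP => b; rewrite inE => /andP[].
rewrite cardsX card_powerset cardsDS // leq_mul2r card_small_subsets orbT //.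
Qed.

Section NoGain.
Variables (V : finType) (t0 t1 t2 : bool) (G : rel V) (X : {set V}).
Hypotheses (symG : symmetric G) (irrG : irreflexive G).
Hypothesis suppG : forall x y, G x y -> x \in X.
Notation S G := (Horients t0 t1 t2 G).
Notation h := (#|X|./2).
Hypothesis nogain : forall v, v \in X -> #|S (delG v G)| * 2 ^ h < 2 * #|S G|.
(** Choosing [k] vertices costs at most [l * k] bits, and [e] is the size, in bits, of the tolerated
    errors. [el] keeps the loss in the container argument below [e]; [hel] keeps the sixfold
    iterated threshold of [negligible_agree] below the size of a part. *)
Variables (l e : nat).
Hypothesis l_gt0 : 0 < l.
Hypothesis lX : #|X| < 2 ^ l.
Hypothesis el : l * (4 + #|X| %/ e) + 20 <= e.
Hypothesis hel : 200 * (e * l ^ 6) <= h.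
Implicit Types (P Q : {set {ffun V * V -> bool}}) (D : {ffun V * V -> bool}) (x y a b c v w : V).

(** * Negligible families and containers *)

Lemma nbr_sub x : nbr G x \subset X.
Proof. by apply/subsetP => y; rewrite inE symG => /suppG. Qed.

Lemma e_ge20 : 20 <= e. Proof. by apply: leq_trans el; rewrite leq_addl. Qed.
Lemma e_ge4l : 4 * l + 20 <= e. Proof. by apply: leq_trans el; rewrite leq_add2r mulnC leq_mul2l leq_addr orbT. Qed.
Lemma e_h : 200 * e <= h.
Proof.
apply: leq_trans hel; rewrite leq_mul2l leq_pmulr ?orbT // expn_gt0.
by rewrite l_gt0.
Qed.
Lemma el_h : 200 * (e * l) <= h.
Proof.
apply: leq_trans hel; rewrite !leq_mul2l -{1}(expn1 l) leq_pexp2l ?l_gt0 ?orbT //.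
Qed.

(** Here [m] counts elementary bad events: the union bound adds these numbers, and a total below
    [2 ^ e] cannot exhaust [S G]. *)
Definition negligible m P := #|P| * 2 ^ e <= m * #|S G|.

Lemma negligibleU m m' P Q : negligible m P -> negligible m' Q -> negligible (m + m') (P :|: Q).
Proof.
move=> nP nQ; rewrite /negligible mulnDl (leq_trans _ (leq_add nP nQ)) //.
by rewrite -mulnDl leq_mul2r leq_card_setU orbT.
Qed.

Lemma negligible_bigcup (I : finType) (A : {set I}) (F : I -> {set {ffun V * V -> bool}}) m :
  (forall i, i \in A -> negligible m (F i)) -> negligible (#|A| * m) (\bigcup_(i in A) F i).
Proof.
move=> nF; rewrite /negligible.
apply: (@leq_trans ((\sum_(i in A) #|F i|) * 2 ^ e)).
  by rewrite leq_mul2r card_bigcup_le orbT.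
rewrite big_distrl /= -mulnA -sum_nat_const leq_sum // => i iA; exact: nF.
Qed.

Lemma negligible_sub m P Q : P \subset Q -> negligible m Q -> negligible m P.
Proof.
by move=> sPQ; apply: leq_trans; rewrite leq_mul2r subset_leq_card ?orbT.
Qed.

Lemma negligible_leq m m' P : m <= m' -> negligible m P -> negligible m' P.
Proof.
by move=> le nP; apply: leq_trans nP _; rewrite leq_mul2r le orbT.
Qed.

Lemma X_gt0 : 0 < #|X|. Proof. by have := e_h; have := e_ge20; lia. Qed.

Lemma S_gt0 : 0 < #|S G|.
Proof.
have [v vX] : exists v, v \in X by apply/card_gt0P/X_gt0.
by have := nogain vX; lia.
Qed.

Lemma not_negligible_all m : m < 2 ^ e -> ~ negligible m (S G).
Proof.
move=> ltm; rewrite /negligible mulnC leq_pmul2r ?S_gt0 //.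
by rewrite leqNgt ltm.
Qed.

(** By [nogain], [2 ^ h] patterns over each orientation of [G - v] amount to less than twice
    [#|S G|]; the [- 1] in the exponent pays for this factor 2. *)
Lemma star_bound v P s : v \in X -> P \subset S G -> s + 1 <= h ->
  (forall D0, #|[set out D v | D in [set D in P | delD v D == D0]]| <= 2 ^ (h - s - 1)) ->
  #|P| * 2 ^ s <= #|S G|.
Proof.
move=> vX sP sh H; have := card_star_extensions symG sP H => le.
suff: 2 * (#|P| * 2 ^ s) < 2 * #|S G| by rewrite ltn_mul2l /= => /ltnW.
apply: leq_ltn_trans (nogain vX); have -> : 2 ^ h = 2 ^ (h - s - 1) * 2 ^ s * 2.
  by rewrite -expnD -expnSr; congr (_ ^ _); lia.
by nia.
Qed.

(** [Zf D] depends only on [D] away from [c], so it is constant on each fibre. There the pattern of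
    [c] on it costs at most [l * k] bits, and the pattern on the other neighbours is free. *)
Lemma negligible_star c P (Zf : {ffun V * V -> bool} -> {set V}) dir k :
  c \in X -> P \subset S G ->
  (forall D D', D \in P -> D' \in P -> delD c D = delD c D' -> Zf D = Zf D') ->
  (forall D, D \in P -> Zf D \subset nbr G c) ->
  (forall D, D \in P -> #|[set b in Zf D | D (c, b) == dir]| <= k) ->
  (forall D, D \in P -> l * k + #|nbr G c| + e + 1 <= h + #|Zf D|) ->
  negligible 1 P.
Proof.
move=> cX sP detZ sZ kZ lkZ; rewrite /negligible mul1n.
apply: (star_bound cX sP) => [|D0]; first by have := e_h; have := e_ge20; lia.
have [-> | [D1]] := set_0Vmem [set D in P | delD c D == D0].
  by rewrite imset0 cards0.
rewrite inE => /andP[PD1 /eqP eD1].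
apply: leq_trans (_ : #|X|.+1 ^ k * 2 ^ (#|nbr G c| - #|Zf D1|) <= _); last first.
  apply: leq_trans (_ : (2 ^ l) ^ k * 2 ^ (#|nbr G c| - #|Zf D1|) <= _).
    by rewrite leq_mul2r leq_expl ?orbT.
  rewrite -expnM -expnD leq_exp2l //.
  by have := lkZ _ PD1; have := subset_leq_card (sZ _ PD1); lia.
apply: leq_trans (_ : #|Zf D1|.+1 ^ k * 2 ^ (#|nbr G c| - #|Zf D1|) <= _); last first.
  rewrite leq_mul2r leq_expl ?orbT // ltnS subset_leq_card //.
  by apply: subset_trans (sZ _ PD1) (nbr_sub c).
apply: leq_trans (card_patterns k dir (sZ _ PD1)).
apply: subset_leq_card; apply/subsetP => _ /imsetP[D + ->].
rewrite !inE => /andP[PD /eqP eD].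
have := subsetP sP _ PD; rewrite inE => /andP[oD _].
rewrite out_sub_nbr //=; rewrite (detZ D1 D) ?eD //.
by apply: leq_trans (kZ _ PD); apply: subset_leq_card; apply/subsetP => b; rewrite !inE.
Qed.

(** A vertex of degree below [h] has at most [2 ^ (h - 1)] patterns, so deleting it would gain. *)
Lemma nbr_ge x : x \in X -> h <= #|nbr G x|.
Proof.
move=> xX; rewrite leqNgt; apply/negP => lt.
have : #|S G| <= 2 ^ #|nbr G x| * #|S (delG x G)|.
  apply: card_star_extensions => // D0.
  rewrite -card_powerset; apply: subset_leq_card; apply/subsetP => _ /imsetP[D + ->].
  by rewrite !inE => /andP[/andP[oD _] _]; apply: out_sub_nbr oD.
have : 2 ^ #|nbr G x|.+1 <= 2 ^ h by rewrite leq_exp2l.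
by have := nogain xX; rewrite expnS; nia.
Qed.

(** If every subset of [N(v)] with [h - e] vertices had a vertex of inner degree at least [e], then
    [N(v)] would have so few independent sets that [v] had at most [2 ^ (h - 2)] patterns. *)
Lemma exists_container v : v \in X -> exists C : {set V},
  [/\ C \subset nbr G v, h - e <= #|C| &
      forall w, w \in C -> #|[set y in C | G w y]| < e].
Proof.
move=> vX; pose good (C : {set V}) := [&& C \subset nbr G v, h - e <= #|C| &
   [forall w in C, #|[set y in C | G w y]| < e]].
have [/existsP[C /and3P[s1 s2 /forall_inP s3]] | /existsPn none] := boolP [exists C, good C].
  by exists C.
have e0 : 0 < e by have := e_ge20; lia.
have ind : #|indsets G (nbr G v)| <= 2 ^ (h - e) * #|nbr G v|.+1 ^ (#|nbr G v| %/ e).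
  apply: card_indsets => // C' sC' mC'.
  have := none C'; rewrite /good sC' mC' /= => /forall_inPn[w wC'].
  rewrite -leqNgt => dw; exists w => //; apply: leq_trans dw _.
  apply: subset_leq_card; apply/subsetP => y; rewrite !inE => /andP[-> Gwy].
  by rewrite Gwy !andbT; apply: contraTneq Gwy => ->; rewrite irrG.
have dX : #|nbr G v| <= #|X| by rewrite subset_leq_card ?nbr_sub.
have: #|S G| * 2 ^ 1 <= #|S G|.
  apply: (star_bound vX (subxx _)) => [|D0]; first by have := e_h; have := e_ge20; lia.
  apply: leq_trans (pajor _) _.
  (* A shattered set splits into a cover [R] of at most four vertices and an independent set. *)
  pose small := [set R : {set V} | (R \subset X) && (#|R| <= 4)].
  apply: (@leq_trans (#|setX small (indsets G (nbr G v))|)); last first.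
    rewrite cardsX; apply: leq_trans (_ : (2 ^ l) ^ 4 * (2 ^ (h - e) * (2 ^ l) ^ (#|X| %/ e)) <= _).
      apply: leq_mul; first by apply: leq_trans (card_small_subsets _ _) _; rewrite leq_exp2r.
      apply: leq_trans ind _; rewrite leq_mul2l; apply/orP; right.
      apply: leq_trans (_ : #|X|.+1 ^ (#|nbr G v| %/ e) <= _); first by rewrite leq_expl.
      apply: leq_trans (_ : #|X|.+1 ^ (#|X| %/ e) <= _); first by rewrite leq_pexp2l // leq_div2r.
      by rewrite leq_expl.
    by rewrite -!expnM -!expnD leq_exp2l //; have := el; have := e_h; nia.
  apply: leq_trans (leq_imset_card (fun u => u.1 :|: u.2) _).
  apply: subset_leq_card; apply/subsetP => A; rewrite inE => /(shattered_no3match symG irrG)[sA].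
  move/(no3match_cover irrG) => [R [sR cR iR]]; apply/imsetP; exists (R, A :\: R); last first.
    by rewrite /= -{1}(setID A R) (setIidPr sR).
  rewrite !inE cR iR /= !andbT (subset_trans sR (subset_trans sA (nbr_sub v))) /=.
  by apply: subset_trans sA; apply: subsetDl.
by have := S_gt0; lia.
Qed.

(** Only the vertices of [A] are controlled, so the notion is asymmetric and is used for a pair in
    both orders. It tolerates unplaced vertices outside [A] and [B], as there are before the
    partition is complete. *)
Definition nearly (A B : {set V}) := [/\ A \subset X, B \subset X, [disjoint A & B],
  #|X :\: (A :|: B)| <= 7 * e &
  forall a, a \in A -> #|nbr G a| <= h + 7 * e /\ #|B :\: nbr G a| <= 7 * e].

Definition apexes s D (B : {set V}) x a := [set b in B | [&& G x b, G a b & tri s D x a b]].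

(** * Triangles across the parts and degrees inside a part *)

Lemma neq_edge x y : G x y -> x != y.
Proof. by apply: contraTneq => ->; rewrite irrG. Qed.

Lemma SP D : D \in S G -> orients G D.
Proof. by rewrite inE => /andP[]. Qed.

(** Delete [a]. For each neighbour [b] of [a] whose arc at [x] is opposite to [xa], the arc [ab]
    alone decides whether [b] is an apex. At least [13 * e] such arcs would be forced up to three
    exceptions, while the degree of [a] exceeds [h] by at most [7 * e]. *)
Lemma negligible_few_apexes A B x a s d : nearly A B -> a \in A -> G x a ->
  negligible 1 [set D in S G | [&& D (x, a) == d,
    20 * e <= #|[set b in B | G x b && (D (x, b) == ~~ d)]| & #|apexes s D B x a| <= 3]].
Proof.
move=> [sA sB dAB _ nearA] aA xa; have [da ma] := nearA a aA; set P := [set D in _ | _].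
have xna := neq_edge xa.
have aP D : D \in P -> [/\ D \in S G, D (x, a) = d,
    20 * e <= #|[set b in B | G x b && (D (x, b) == ~~ d)]| & #|apexes s D B x a| <= 3].
  by rewrite inE => /andP[-> /and3P[/eqP-> -> ->]].
pose Zf D := [set b in B | [&& G x b, G a b & D (x, b) == ~~ d]].
apply: (@negligible_star a P Zf (d == s) 3).
- exact: (subsetP sA).
- by apply/subsetP => D /aP[].
- move=> D D' _ _ eD; apply/setP => b; rewrite !inE; case: (b \in B) => //=.
  case: (G x b) => //=; have [ab | //] := boolP (G a b).
  by rewrite (delD_eq xna _ eD) // eq_sym neq_edge.
- by move=> D _; apply/subsetP => b; rewrite !inE => /and4P[].
- move=> D /aP[SD xd _ le3]; apply: leq_trans le3; apply: subset_leq_card.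
  apply/subsetP => b; rewrite !inE => /andP[/and4P[-> xb ab /eqP xbd] abd].
  by rewrite xb ab (triE _ symG (SP SD)) // xbd xd (eqP abd) eqxx; case: (d).
move=> D /aP[_ _ ge20 _]; set W := [set b in B | _] in ge20.
have le : #|W| <= #|Zf D| + #|B :\: nbr G a|.
  apply: leq_trans (leq_card_setU _ _); apply: subset_leq_card; apply/subsetP => b.
  by rewrite !inE => /and3P[-> -> ->]; case: (G a b).
by move: le ge20 ma da e_ge4l; clear; lia.
Qed.

Lemma card_nbr_setU A B x : nearly A B ->
  #|nbr G x| <= #|nbr G x :&: (A :|: B)| + 7 * e.
Proof.
move=> [_ _ _ leR _]; rewrite -(cardsID (A :|: B)) leq_add2l (leq_trans _ leR) //.
by rewrite subset_leq_card // setSD // nbr_sub.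
Qed.

(** Such an [x] has only about [2 ^ (l * (20 * e + 2) + 7 * e)] patterns, far fewer than [2 ^ h].
    The summand 2 makes room for two neighbours inside [A]. *)
Lemma negligible_few_out A B x d : nearly A B -> x \in X ->
  negligible 1 [set D in S G |
    #|[set b in nbr G x :&: (A :|: B) | D (x, b) == d]| <= 20 * e + 2].
Proof.
move=> nAB xX; set P := [set D in _ | _].
apply: (@negligible_star x P (fun=> nbr G x :&: (A :|: B)) d (20 * e + 2)) => //.
- by apply/subsetP => D; rewrite inE => /andP[].
- by move=> D _; apply: subsetIl.
- by move=> D; rewrite inE => /andP[].
by move=> D _; have := card_nbr_setU x nAB; have := el_h; have := e_h; have := e_ge4l; nia.
Qed.

(** Distinct apexes are chosen greedily, giving three triangles that share only [x]. *)
Lemma no_three_apexes D (A B : {set V}) x a0 a1 a2 : D \in S G -> [disjoint A & B] ->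
  a0 \in A -> a1 \in A -> a2 \in A -> a0 != a1 -> a0 != a2 -> a1 != a2 ->
  G x a0 -> G x a1 -> G x a2 ->
  3 < #|apexes t0 D B x a0| -> 3 < #|apexes t1 D B x a1| -> 3 < #|apexes t2 D B x a2| -> False.
Proof.
rewrite inE => /andP[oD /HfreeP fD] dAB a0A a1A a2A n01 n02 n12 x0 x1 x2 c0 c1 c2.
have [b0 b0W _] := @card_gt_notin _ _ [::] (ltn_trans (isT : 0 < 3) c0).
have [b1 b1W] := @card_gt_notin _ _ [:: b0] (ltn_trans (isT : 1 < 3) c1).
have [b2 b2W] := @card_gt_notin _ _ [:: b0; b1] (ltn_trans (isT : 2 < 3) c2).
move: b0W b1W b2W; rewrite !inE => /and4P[B0 xb0 _ T0] /and4P[B1 xb1 _ T1] /and4P[B2 xb2 _ T2].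
rewrite negb_or => /andP[n20 n21] n10.
apply: (fD _ _ _ _ _ _ _ _ T0 T1 T2).
have nAB a b : a \in A -> b \in B -> a != b.
  by move=> aA bB; apply: contraTneq bB => <-; rewrite (disjointFr dAB).
rewrite /= !inE !negb_or -!andbA !(neq_edge x0) !(neq_edge x1) !(neq_edge x2).
rewrite !(neq_edge xb0) !(neq_edge xb1) !(neq_edge xb2) /=.
have nBA a b : a \in A -> b \in B -> b != a by rewrite eq_sym; apply: nAB.
by do ?[apply/andP; split]; first [done | exact: nAB | exact: nBA | rewrite eq_sym].
Qed.

(** Suppose that [x] has three neighbours in [A]. Outside the bad families, a neighbour [a] has many
    apexes of both types once [x] has [20 * e] arcs into [B] opposite to [xa]. If both directions
    are frequent towards [B], any three neighbours in [A] give a copy of H. If the direction [d] is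
    rare, at most two neighbours in [A] have it, so it is rare at [x] altogether, which is a bad
    event too. *)
Lemma deg_le2 A B x : nearly A B -> x \in X -> h - 10 * e <= #|nbr G x :&: B| ->
  #|nbr G x :&: A| <= 2.
Proof.
move=> nAB xX xB; have [sA sB dAB leR nearA] := nAB.
rewrite leqNgt; apply/negP => gt2.
pose P a s d := [set D in S G | [&& D (x, a) == d,
    20 * e <= #|[set b in B | G x b && (D (x, b) == ~~ d)]| & #|apexes s D B x a| <= 3]].
pose Q d := [set D in S G |
    #|[set b in nbr G x :&: (A :|: B) | D (x, b) == d]| <= 20 * e + 2].
pose P' a := P a true true :|: P a true false :|: (P a false true :|: P a false false).
have nP' a : a \in nbr G x :&: A -> negligible 4 (P' a).
  rewrite !inE => /andP[xa aA].
  by apply: (negligibleU (m := 2) (m' := 2)); apply: (negligibleU (m := 1) (m' := 1));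
    apply: negligible_few_apexes nAB _ _.
have nBad := negligibleU (negligible_bigcup nP') (negligibleU
  (negligible_few_out true nAB xX) (negligible_few_out false nAB xX)).
apply: (not_negligible_all _ (negligible_sub _ nBad)).
  apply: leq_ltn_trans (_ : #|X| * 4 + (1 + 1) < _).
    by rewrite leq_add2r leq_mul2r subset_leq_card // (subset_trans (subsetIr _ _)).
  apply: leq_trans (_ : 2 ^ (l + 3) <= _); last by rewrite leq_exp2l //; move: e_ge4l; clear; lia.
  by rewrite expnD; move: lX; clear; lia.
apply/subsetP => D SD; apply/negPn/negP; rewrite in_setU negb_or => /andP[/bigcupP nP nQ].
have manyA a s : a \in A -> G x a ->
    20 * e <= #|[set b in B | G x b && (D (x, b) == ~~ D (x, a))]| -> 3 < #|apexes s D B x a|.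
  move=> aA xa ge20; rewrite ltnNge; apply/negP => le3; apply: nP.
  exists a; first by rewrite !inE xa aA.
  have: D \in P a s (D (x, a)) by rewrite inE SD eqxx ge20 le3.
  by rewrite /P' !inE; case: s {le3}; case: (D (x, a)) ge20 => ge20 ->; rewrite ?orbT.
have no3 a0 a1 a2 : a0 \in A -> a1 \in A -> a2 \in A -> a0 != a1 -> a0 != a2 -> a1 != a2 ->
    G x a0 -> G x a1 -> G x a2 ->
    (forall a, a \in [:: a0; a1; a2] ->
       20 * e <= #|[set b in B | G x b && (D (x, b) == ~~ D (x, a))]|) -> False.
  move=> A0 A1 A2 n01 n02 n12 x0 x1 x2 H.
  by apply: (no_three_apexes (x := x) SD dAB A0 A1 A2) => //; apply: manyA => //; apply: H;
    rewrite !inE eqxx ?orbT.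
have few d : #|[set b in B | G x b && (D (x, b) == d)]| < 20 * e ->
    20 * e <= #|[set b in B | G x b && (D (x, b) == ~~ d)]|.
  move=> lt20; have : #|nbr G x :&: B| <= #|[set b in B | G x b && (D (x, b) == d)]| +
      #|[set b in B | G x b && (D (x, b) == ~~ d)]|.
    apply: leq_trans (leq_card_setU _ _); apply: subset_leq_card; apply/subsetP => b.
    by rewrite !inE => /andP[-> ->]; case: (D _); case: (d).
  by move: lt20 xB e_h; clear; lia.
have one d : #|[set b in B | G x b && (D (x, b) == d)]| < 20 * e -> False.
  move=> lt20; have ge20 := few _ lt20.
  have : #|[set a in nbr G x :&: A | D (x, a) == d]| <= 2.
    rewrite leqNgt; apply/negP => /card_gt2P[a0 [a1 [a2 [[+ + +] [n01 n12 n20]]]]].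
    rewrite !inE => /andP[/andP[x0 A0] /eqP d0] /andP[/andP[x1 A1] /eqP d1] /andP[/andP[x2 A2] /eqP d2].
    apply: (no3 a0 a1 a2) => // [|a]; first by rewrite eq_sym.
    by rewrite !inE => /or3P[] /eqP->; rewrite ?d0 ?d1 ?d2.
  move=> le2; have : D \in Q d.
    rewrite inE SD /= addnC.
    apply: leq_trans (_ : #|[set a in nbr G x :&: A | D (x, a) == d]| +
      #|[set b in B | G x b && (D (x, b) == d)]| <= _); last by rewrite leq_add ?(ltnW lt20).
    apply: leq_trans (leq_card_setU _ _); apply: subset_leq_card; apply/subsetP => b.
    by rewrite !inE; case: (G x b); case: (b \in A); case: (b \in B); case: (D (x, b) == d).
  move: nQ; rewrite in_setU negb_or => /andP[/negP q1 /negP q2].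
  by case: (d).
have [lt|ge1] := ltnP #|[set b in B | G x b && (D (x, b) == true)]| (20 * e); first exact: one lt.
have [lt|ge0] := ltnP #|[set b in B | G x b && (D (x, b) == false)]| (20 * e); first exact: one lt.
have /card_gt2P[a0 [a1 [a2 [[+ + +] [n01 n12 n20]]]]] := gt2.
rewrite !inE => /andP[x0 A0] /andP[x1 A1] /andP[x2 A2].
apply: (no3 a0 a1 a2) => // [|a]; first by rewrite eq_sym.
by move=> _; case: (D (x, a)).
Qed.

(** With at most two neighbours in [A], a shortage of arcs opposite to [xa] towards [B] is a
    shortage at [x] altogether, hence negligible. *)
Lemma negligible_few_apexes_deg2 A B x a s : nearly A B -> x \in X -> a \in A -> G x a ->
  #|nbr G x :&: A| <= 2 -> negligible 4 [set D in S G | #|apexes s D B x a| <= 3].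
Proof.
move=> nAB xX aA xa deg2.
pose P d := [set D in S G | [&& D (x, a) == d,
    20 * e <= #|[set b in B | G x b && (D (x, b) == ~~ d)]| & #|apexes s D B x a| <= 3]].
pose Q d := [set D in S G |
    #|[set b in nbr G x :&: (A :|: B) | D (x, b) == d]| <= 20 * e + 2].
have nP d : negligible 1 (P d) by apply: negligible_few_apexes nAB _ _.
have nQ d : negligible 1 (Q d) by apply: negligible_few_out nAB _.
apply: negligible_sub (negligibleU (negligibleU (nP true) (nP false))
                                   (negligibleU (nQ true) (nQ false))).
apply/subsetP => D; rewrite inE => /andP[SD le3].
have: (D \in P (D (x, a))) || (D \in Q (~~ D (x, a))).
  rewrite [D \in P _]inE [D \in Q _]inE SD le3 eqxx /= andbT; case: leqP => //= lt20.
  rewrite addnC.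
  apply: leq_trans (_ : #|nbr G x :&: A| +
    #|[set b in B | G x b && (D (x, b) == ~~ D (x, a))]| <= _); last by rewrite leq_add ?(ltnW lt20).
  apply: leq_trans (leq_card_setU _ _); apply: subset_leq_card; apply/subsetP => b.
  by rewrite !inE; case: (G x b); case: (b \in A); case: (b \in B); case: (D (x, b) == ~~ D (x, a)).
by rewrite !in_setU; case: (D (x, a)) => /orP[] ->; rewrite ?orbT.
Qed.

Definition agree D (B : {set V}) (cs : seq (V * bool)) :=
  [set b in B | all (fun p => G p.1 b && (D (p.1, b) == p.2)) cs].

(** Constraints are imposed one vertex at a time. If [l * t + 20 * e] vertices of [B] satisfy those
    in [cs], then, deleting [c], it is negligible that at most [t] of them also satisfy the one at
    [c]. *)
Lemma negligible_agree A B cs t : nearly A B -> uniq (map fst cs) ->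
  {subset map fst cs <= A} -> iter (size cs) (fun t => l * t + 20 * e) t <= #|B| ->
  negligible (size cs) [set D in S G | #|agree D B cs| < t].
Proof.
move=> nAB; have [sA _ _ _ nearA] := nAB.
elim: cs t => [|[c d] cs IH] t.
  move=> _ _ /= tB; rewrite /negligible mul0n leqn0 muln_eq0 cards_eq0 -subset0.
  apply/orP; left; apply/subsetP => D; rewrite !inE => /andP[_].
  have -> : agree D B [::] = B by apply/setP => b; rewrite !inE andbT.
  by rewrite ltnNge tB.
move=> /andP[ncs Ucs] scs; rewrite [size _]/= iterSr => leB.
have cA : c \in A by apply: scs; rewrite inE eqxx.
have [dc mc] := nearA c cA.
have scs' : {subset map fst cs <= A} by move=> z zcs; apply: scs; rewrite inE zcs orbT.
pose P := [set D in S G | (l * t + 20 * e <= #|agree D B cs|) && (#|agree D B ((c, d) :: cs)| <= t)].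
have nP : negligible 1 P.
  apply: (@negligible_star c P (fun D => agree D B cs :&: nbr G c) d t).
  - exact: (subsetP sA).
  - by apply/subsetP => D; rewrite inE => /andP[].
  - move=> D D' _ _ eD; apply/setP => b; rewrite !inE -!andbA; case: (b \in B) => //=.
    have [cb | ] := boolP (G c b); rewrite ?andbF ?andbT //; apply: eq_in_all => -[c' d'] c'cs /=.
    case: (G c' b) => //=; congr (_ == _); apply: delD_eq eD.
      by apply: contraNneq ncs => <-; apply/mapP; exists (c', d').
    by rewrite eq_sym neq_edge.
  - by move=> D _; apply: subsetIr.
  - move=> D; rewrite inE => /and3P[_ _]; apply: leq_trans; apply: subset_leq_card.
    apply/subsetP => b; rewrite !inE /= -!andbA => /and4P[-> -> -> ->]; done.
  move=> D; rewrite inE => /and3P[_ ge _].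
  have : #|agree D B cs| <= #|agree D B cs :&: nbr G c| + #|B :\: nbr G c|.
    apply: leq_trans (leq_card_setU _ _); apply: subset_leq_card; apply/subsetP => b.
    by rewrite !inE => /andP[-> ->]; case: (G c b).
  by move: mc dc ge e_ge20; clear; lia.
apply: negligible_sub (negligibleU nP (IH _ Ucs scs' leB)).
apply/subsetP => D; rewrite in_setU !inE => /andP[SD lt].
rewrite SD /=; case: leqP => //= _; rewrite orbF; exact: ltnW.
Qed.

Lemma iter_threshold k : iter k (fun t => l * t + 20 * e) 1 <= (1 + 20 * e * k) * l ^ k.
Proof.
elim: k => [|k IH]; first by rewrite muln0 addn0.
rewrite iterS expnS; apply: leq_trans (_ : l * ((1 + 20 * e * k) * l ^ k) + 20 * e <= _).
  by rewrite leq_add2r leq_mul2l IH orbT.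
have : 0 < l * l ^ k by rewrite -expnS expn_gt0 l_gt0.
by nia.
Qed.

(** Given three disjoint edges in [A], in almost all orientations some [b] in [B] has prescribed
    directions to their six ends and is the centre of a copy of H. The eight directions of the
    edges, with six events each, make 48 events, fewer than [2 ^ 6]. *)
Lemma nearly_no3match A B : nearly A B -> h - 10 * e <= #|B| -> no3match G A.
Proof.
move=> nAB leB p0 q0 p1 q1 p2 q2 U sub e0 e1 e2.
have [sA _ dAB _ _] := nAB.
(* The signs are those for which [b], [p_i] and [q_i] span a triangle of type [t_i] at [b] when
   [D (p_i, q_i) = o_i]. *)
pose cs o0 o1 o2 := [:: (p0, o0 != t0); (q0, o0 == t0); (p1, o1 != t1); (q1, o1 == t1);
  (p2, o2 != t2); (q2, o2 == t2)].
pose F (o : bool * bool * bool) := [set D in S G | #|agree D B (cs o.1.1 o.1.2 o.2)| < 1].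
have nF o : o \in [set: bool * bool * bool] -> negligible 6 (F o).
  move=> _; apply: (@negligible_agree A B (cs _ _ _)) => //.
  apply: leq_trans (iter_threshold 6) _; apply: leq_trans _ leB.
  have : 0 < l ^ 6 by rewrite expn_gt0 l_gt0.
  by move: hel e_h e_ge20; clear; nia.
apply: (not_negligible_all _ (negligible_sub _ (negligible_bigcup nF))).
  rewrite cardsT !card_prod card_bool; apply: (@leq_trans (2 ^ 6)) => //.
  by rewrite leq_exp2l //; have := e_ge20; lia.
apply/subsetP => D SD; have oD := SP SD.
apply/bigcupP; exists (D (p0, q0), D (p1, q1), D (p2, q2)); first by rewrite inE.
rewrite inE SD /= ltnS leqn0 cards_eq0; apply/negPn/negP => /set0Pn[b].
rewrite inE /= -!andbA andbT => /and5P[bB p0b /eqP dp0 q0b].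
case/and5P=> [/eqP dq0 p1b /eqP dp1 q1b] /and5P[/eqP dq1 p2b /eqP dp2 q2b /eqP dq2].
move: SD; rewrite inE => /andP[_ /HfreeP fD].
have [H _] := orientsP _ symG oD.
apply: (fD b p0 q0 p1 q1 p2 q2).
- rewrite cons_uniq U andbT; apply/negP => /sub bA.
  by rewrite (disjointFr dAB bA) in bB.
- by rewrite (triE _ symG oD) // 1?symG // (H _ _ p0b) (H _ _ q0b) dp0 dq0; case: (D _); case: (t0).
- by rewrite (triE _ symG oD) // 1?symG // (H _ _ p1b) (H _ _ q1b) dp1 dq1; case: (D _); case: (t1).
by rewrite (triE _ symG oD) // 1?symG // (H _ _ p2b) (H _ _ q2b) dp2 dq2; case: (D _); case: (t2).
Qed.

(** * From containers to a bipartition *)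

Lemma card_nbrID (C : {set V}) x : #|nbr G x| = #|nbr G x :&: C| + #|nbr G x :&: (X :\: C)|.
Proof.
rewrite -(cardsID C); congr (_ + _); apply: eq_card => y; rewrite !inE.
have [xy | _] := boolP (G x y); rewrite ?andbF //= (@suppG y x) ?andbT //.
by rewrite symG.
Qed.

Lemma card_X_le : #|X| <= (h + h).+1.
Proof. by have := odd_double_half #|X|; rewrite -addnn; case: odd; clear; lia. Qed.

(** A vertex of [C] has at least [h] neighbours, fewer than [e] of them in [C], and only about [h]
    vertices lie outside [C]; so it is joined to almost all of these. *)
Lemma sparse_nbr (C : {set V}) j : C \subset X -> h - j <= #|C| ->
  (forall w, w \in C -> #|nbr G w :&: C| < e) ->
  #|X :\: C| <= h + j + 1 /\
  (forall w, w \in C -> #|nbr G w| <= h + j + e + 1 /\ #|X :\: C :\: nbr G w| <= j + e + 1).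
Proof.
move=> sC leC sparse; have cX := cardsID C X; rewrite (setIidPr sC) in cX.
have le : #|X :\: C| <= h + j + 1.
  by move: cX leC card_X_le; clear; lia.
split=> // w wC; have lt := sparse w wC; have dw := nbr_ge (subsetP sC w wC).
have := card_nbrID C w; have := cardsID (nbr G w) (X :\: C).
rewrite (setIC (X :\: C)); move: lt dw le; clear; lia.
Qed.

Lemma dense_partition (A B : {set V}) : A :|: B = X -> [disjoint A & B] ->
  (forall x, x \in A -> #|nbr G x :&: A| <= 4 * e) -> #|B| <= h + 2 * e + 1 ->
  nearly A B /\ (forall x, x \in A -> h - 10 * e <= #|nbr G x :&: B|).
Proof.
move=> eqX dAB degA leB; have sA : A \subset X by rewrite -eqX subsetUl.
have sB : B \subset X by rewrite -eqX subsetUr.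
have eqB : X :\: A = B by rewrite -eqX setDUl setDv set0U; apply/setDidPl; rewrite disjoint_sym.
have degB x : x \in A -> h <= 4 * e + #|nbr G x :&: B|.
  move=> xA; have := card_nbrID A x; rewrite eqB.
  by have := nbr_ge (subsetP sA x xA); have := degA x xA; clear; lia.
split; last by move=> x /degB; clear; lia.
split=> //; first by rewrite eqX setDv cards0.
move=> x xA; have := degA x xA; have := degB x xA; have := card_nbrID A x; rewrite eqB.
have := cardsID (nbr G x) B; rewrite (setIC B).
have := subset_leq_card (subsetIr (nbr G x) B).
by move: leB e_ge20; clear; lia.
Qed.

(** A container [A0] and the part outside [A0] of a container in the neighbourhood of a vertex of
    [A0] form a rough pair. The other vertices are placed by their neighbours in [B0]. Then
    [deg_le2] is used twice: for the rough pair it shows that the full partition is nearly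
    bipartite, and for the full partition it gives the degree bound 2. *)
Lemma exists_partition : exists A B : {set V},
  [/\ A :|: B = X, [disjoint A & B], nearly A B, nearly B A &
   [/\ (forall x, x \in A -> #|nbr G x :&: A| <= 2), (forall x, x \in B -> #|nbr G x :&: B| <= 2),
       no3match G A & no3match G B]].
Proof.
have [v0 v0X] : exists v, v \in X by apply/card_gt0P/X_gt0.
have cont v : v \in X -> exists C : {set V}, [/\ C \subset nbr G v, h - e <= #|C| &
      forall w, w \in C -> #|nbr G w :&: C| < e].
  move=> /exists_container[C [sC cC dC]]; exists C; split=> // w /dC.
  by congr (_ < e); apply: eq_card => y; rewrite !inE andbC.
have [A0 [sA0 cA0 dA0]] := cont v0 v0X.
have sA0X := subset_trans sA0 (nbr_sub v0).
have [xA0 nA0] := sparse_nbr sA0X cA0 dA0.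
have [w0 w0A] : exists w, w \in A0.
  by apply/card_gt0P; move: cA0 e_h e_ge20; clear; lia.
have [C1 [sC1 cC1 dC1]] := cont w0 (subsetP sA0X _ w0A).
pose B0 := C1 :\: A0.
have sB0X : B0 \subset X.
  by apply: subset_trans (subsetDl _ _) (subset_trans sC1 (nbr_sub _)).
have cB0 : h - 2 * e <= #|B0|.
  have := cardsID A0 C1; rewrite -/B0.
  have := subset_leq_card (setSI A0 sC1); have := dA0 _ w0A.
  by move: cC1; clear; lia.
have dB0 w : w \in B0 -> #|nbr G w :&: B0| < e.
  rewrite inE => /andP[_ /dC1]; apply: leq_ltn_trans; rewrite subset_leq_card //.
  by rewrite setIS // subsetDl.
have [xB0 nB0] := sparse_nbr sB0X cB0 dB0.
have dis0 : [disjoint A0 & B0].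
  by rewrite disjoint_sym disjoints_subset /B0 setDE subsetIr.
have sB0D : B0 \subset X :\: A0 by rewrite subsetD sB0X disjoint_sym.
have sA0D : A0 \subset X :\: B0 by rewrite subsetD sA0X.
have cR : #|X :\: (A0 :|: B0)| <= 3 * e + 1.
  have := cardsID (A0 :|: B0) X; rewrite (setIidPr _) ?subUset ?sA0X //.
  rewrite cardsU (eqP (_ : A0 :&: B0 == set0)) ?setI_eq0 // cards0.
  by move: cA0 cB0 card_X_le; clear; lia.
have nearAB : nearly A0 B0.
  split=> //; first by move: cR e_ge20; clear; lia.
  move=> a aA; have [da ma] := nA0 a aA; split; first by move: da e_ge20; clear; lia.
  by have := subset_leq_card (setSD (nbr G a) sB0D); move: ma e_ge20; clear; lia.
have nearBA : nearly B0 A0.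
  split=> //; [by rewrite disjoint_sym | by rewrite setUC; move: cR e_ge20; clear; lia |].
  move=> a aA; have [da ma] := nB0 a aA; split; first by move: da e_ge20; clear; lia.
  by have := subset_leq_card (setSD (nbr G a) sA0D); move: ma e_ge20; clear; lia.
(* The container [C] of [x] is sparse, while a vertex of [A0] is joined to almost all of [B0]. So if
   [C] meets [A0], it has few vertices in [B0]. *)
have dich x : x \in X -> h - 10 * e <= #|nbr G x :&: B0| \/ h - 10 * e <= #|nbr G x :&: A0|.
  move=> xX; have [C [sC cC dC]] := cont x xX.
  have sCX := subset_trans sC (nbr_sub x).
  have cC' : #|C| <= #|C :&: A0| + #|C :&: B0| + (3 * e + 1).
    have := cardsID (A0 :|: B0) C; have := subset_leq_card (setSD (A0 :|: B0) sCX).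
    have : #|C :&: (A0 :|: B0)| <= #|C :&: A0| + #|C :&: B0|.
      by rewrite setIUr leq_card_setU.
    by move: cR; clear; lia.
  have := subset_leq_card (setSI A0 sC); have := subset_leq_card (setSI B0 sC).
  have [eq0 | [a]] := set_0Vmem (C :&: A0).
    by left; move: cC'; rewrite eq0 cards0; move: cC e_ge20 H H0; clear; lia.
  rewrite inE => /andP[aC aA0]; right.
  have cCB : #|C :&: B0| <= 3 * e + 1.
    have : #|C :&: B0| <= #|nbr G a :&: C| + #|X :\: A0 :\: nbr G a|.
      apply: leq_trans (leq_card_setU _ _); apply: subset_leq_card; apply/subsetP => y.
      rewrite !inE => /and3P[yC nyA yC1]; rewrite yC nyA (subsetP sCX) //=.
      by case: (G a y).
    by have [_] := nA0 a aA0; have := dC a aC; clear; lia.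
  by move: cC cC' cCB e_ge20 H H0; clear; lia.
pose A := [set x in X | h - 10 * e <= #|nbr G x :&: B0|].
pose B := X :\: A.
have sA0A : A0 \subset A.
  apply/subsetP => a aA0; rewrite inE (subsetP sA0X) //=.
  have [_ ma] := nA0 a aA0; have := subset_leq_card (setSD (nbr G a) sB0D).
  have := cardsID (nbr G a) B0; rewrite (setIC B0).
  by move: ma cB0 e_ge20; clear; lia.
have sB0B : B0 \subset B.
  apply/subsetP => b bB0; rewrite !inE (subsetP sB0X) //= andbT -ltnNge.
  by have := dB0 b bB0; move: e_h e_ge20; clear; lia.
have eqX : A :|: B = X.
  by apply/setP => x; rewrite !inE; case: (x \in X) => //=; case: (_ <= _).
have dAB : [disjoint A & B].
  by rewrite disjoint_sym disjoints_subset /B setDE subsetIr.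
have sAR : A :\: A0 \subset X :\: (A0 :|: B0).
  apply/subsetP => x; rewrite in_setD => /andP[nx xA]; rewrite !in_setD in_setU negb_or nx /=.
  rewrite -eqX in_setU xA andbT; apply/negP => /(subsetP sB0B).
  by rewrite (disjointFr dAB xA).
have sBR : B :\: B0 \subset X :\: (A0 :|: B0).
  apply/subsetP => x; rewrite in_setD => /andP[nx xB]; rewrite !in_setD in_setU negb_or nx /=.
  rewrite -eqX in_setU xB orbT !andbT; apply/negP => /(subsetP sA0A) xA.
  by rewrite (disjointFr dAB xA) in xB.
(* There are at most two neighbours in [A0] by [deg_le2], and at most [3 * e + 1] vertices of [A]
   outside [A0]. *)
have degA x : x \in A -> #|nbr G x :&: A| <= 4 * e.
  rewrite inE => /andP[xX xB]; have := deg_le2 nearAB xX xB.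
  have : #|nbr G x :&: A| <= #|nbr G x :&: A0| + #|A :\: A0|.
    apply: leq_trans (leq_card_setU _ _); apply: subset_leq_card; apply/subsetP => y.
    by rewrite !in_setU !in_setI !in_setD => /andP[-> ->]; case: (y \in A0).
  by have := subset_leq_card sAR; move: cR e_ge20; clear; lia.
have degB x : x \in B -> #|nbr G x :&: B| <= 4 * e.
  rewrite !inE negb_and => /andP[+ xX]; rewrite xX /= => /negP nB.
  have xA : h - 10 * e <= #|nbr G x :&: A0| by case: (dich x xX).
  have := deg_le2 nearBA xX xA.
  have : #|nbr G x :&: B| <= #|nbr G x :&: B0| + #|B :\: B0|.
    apply: leq_trans (leq_card_setU _ _); apply: subset_leq_card; apply/subsetP => y.
    by rewrite in_setU !in_setI (in_setD B) => /andP[-> ->]; case: (y \in B0).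
  by have := subset_leq_card sBR; move: cR e_ge20; clear; lia.
have cB : #|B| <= h + 2 * e + 1.
  by have := subset_leq_card (setDS X sA0A); rewrite -/B; move: xA0; clear; lia.
have cA : #|A| <= h + 2 * e + 1.
  apply: leq_trans xB0; apply: subset_leq_card; rewrite subsetD -{1}eqX subsetUl /=.
  by apply: disjointWr sB0B dAB.
have [nAB xAB] := dense_partition eqX dAB degA cB.
have eqX' : B :|: A = X by rewrite setUC.
have dBA : [disjoint B & A] by rewrite disjoint_sym.
have [nBA xBA] := dense_partition eqX' dBA degB cA.
have XA x : x \in A -> x \in X by rewrite -eqX in_setU => ->.
have XB x : x \in B -> x \in X by rewrite -eqX in_setU orbC => ->.
exists A, B; split=> //; split.
- by move=> x xA; apply: deg_le2 nAB (XA _ xA) (xAB _ xA).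
- by move=> x xB; apply: deg_le2 nBA (XB _ xB) (xBA _ xB).
- apply: nearly_no3match nAB _.
  by apply: leq_trans (subset_leq_card sB0B); move: cB0; clear; lia.
apply: nearly_no3match nBA _.
by apply: leq_trans (subset_leq_card sA0A); move: cA0; clear; lia.
Qed.

(** Outside [Bad], a vertex [x] of [A] with two neighbours in [A] has enough apexes to complete
    triangles of types [t1] and [t2] through them. A triangle of type [t0] at [x] on an edge of [B]
    would complete a copy of H, so [card_mixed] applies. *)
Lemma mixed_le (A B : {set V}) (a b : nat) : A :|: B = X -> [disjoint A & B] -> nearly A B ->
  (forall x, x \in A -> #|nbr G x :&: A| <= 2) -> (forall x, x \in B -> #|nbr G x :&: B| <= 2) ->
  no3match G A -> no3match G B ->
  \sum_(x in A) #|nbr G x :&: A| = 2 * a -> \sum_(x in B) #|nbr G x :&: B| = 2 * b ->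
  b <= a -> 0 < b -> 7 <= a + b -> #|S G| <= 2 ^ (#|A| * #|B| + 6).
Proof.
move=> eqX dAB nAB degA degB no3A no3B ea eb ba b0 ab.
have suppG' x y : G x y -> x \in A :|: B by rewrite eqX; apply: suppG.
have sAX : A \subset X by rewrite -eqX subsetUl.
pose few s x z := [set D in S G | #|apexes s D B x z| <= 3].
pose Bad := \bigcup_(x in A) \bigcup_(z in nbr G x :&: A) (few t1 x z :|: few t2 x z).
have nBad : negligible (#|X| * 16) Bad.
  apply: (negligible_leq (m := #|A| * 16)); first by rewrite leq_mul2r subset_leq_card ?orbT.
  apply: negligible_bigcup => x xA.
  apply: (negligible_leq (m := #|nbr G x :&: A| * 8)).
    by rewrite (leq_mul (n1 := 2) (n2 := 8)) // degA.
  apply: negligible_bigcup => z; rewrite !inE => /andP[xz zA].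
  by apply: (negligibleU (m := 4) (m' := 4)); apply: negligible_few_apexes_deg2 nAB _ zA xz (degA x xA);
    apply: (subsetP sAX).
have Bad64 : 64 * #|Bad| <= #|S G|.
  rewrite -(leq_pmul2r (_ : 0 < 2 ^ e)) ?expn_gt0 // -mulnA.
  apply: leq_trans (leq_mul (leqnn 64) nBad) _; rewrite mulnA (mulnC #|S G|) leq_mul2r.
  apply/orP; right; apply: (@leq_trans (2 ^ 10 * 2 ^ l)).
    rewrite [X in X <= _](_ : _ = 2 ^ 10 * #|X|); last by move: #|X|; clear; lia.
    by rewrite leq_mul2l (ltnW lX) orbT.
  by rewrite -expnD leq_exp2l //; move: e_ge4l l_gt0; clear; lia.
pose P := S G :\: Bad.
have oP D : D \in P -> orients G D by rewrite in_setD => /andP[_ /SP].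
have := card_mixed symG irrG dAB suppG' oP _ degA degB no3A no3B ea eb ba b0 ab (t := t0).
have triP D x y y' : D \in P -> x \in [set x in A | #|nbr G x :&: A| == 2] -> y \in B -> y' \in B ->
    G x y -> G x y' -> G y y' -> ~~ tri t0 D x y y'.
  rewrite in_setD => /andP[nB SD]; rewrite inE => /andP[xA /cards2P[a1 [a2 [na eqN]]]].
  move=> yB yB' xy xy' yy'; apply/negP => T0.
  have : a1 \in nbr G x :&: A by rewrite eqN !inE eqxx.
  have : a2 \in nbr G x :&: A by rewrite eqN !inE eqxx orbT.
  move=> N2 N1; have many s z : z \in nbr G x :&: A -> (s == t1) || (s == t2) ->
      3 < #|apexes s D B x z|.
    move=> Nz st; rewrite ltnNge; apply: contra nB => le3.
    apply/bigcupP; exists x => //; apply/bigcupP; exists z => //.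
    by case/orP: st => /eqP eqs; rewrite in_setU ![D \in few _ _ _]inE SD -eqs le3 ?orbT.
  (* More than three apexes suffice: [b2] has to avoid just [y], [y'] and [b1]. *)
  have [b1 b1W] := card_gt_notin (s := [:: y; y']) (ltn_trans (isT : 2 < 3) (many t1 a1 N1 (predU1l _ (erefl _)))).
  have m2 : 3 < #|apexes t2 D B x a2| by apply: many; rewrite ?eqxx ?orbT.
  have [b2 b2W] := card_gt_notin (s := [:: y; y'; b1]) m2.
  move: b1W b2W; rewrite !inE !negb_or.
  move=> /and4P[B1 xb1 _ T1] /and4P[B2 xb2 _ T2] /and3P[n1 n2 n3] /andP[n4 n5].
  move: N1 N2; rewrite !inE => /andP[xa1 A1] /andP[xa2 A2].
  move: SD; rewrite inE => /andP[_ /HfreeP fD]; apply: (fD _ _ _ _ _ _ _ _ T0 T1 T2).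
  have nABl c d : c \in A -> d \in B -> c != d.
    by move=> cA dB; apply: contraTneq dB => <-; rewrite (disjointFr dAB).
  have nABr c d : c \in A -> d \in B -> d != c by rewrite eq_sym; apply: nABl.
  rewrite /= !inE !negb_or -!andbA.
  by do ?[apply/andP; split]; first [done | exact: neq_edge | exact: nABl | exact: nABr | by rewrite eq_sym].
move/(_ triP) => le.
have : #|S G| <= #|P| + #|Bad|.
  rewrite -(cardsID Bad) addnC leq_add2l subset_leq_card //; exact: subsetIr.
(* With [M] the claimed bound, [64 * #|P| <= 63 * M] and [64 * #|Bad| <= #|S G|] give
   [63 * #|S G| <= 63 * M]. *)
by move: le Bad64; clear; lia.
Qed.

Lemma card_Horients_le : #|S G| <= 2 ^ (#|X| ^ 2 %/ 4 + 6).
Proof.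
have [A [B [eqX dAB nAB nBA [degA degB no3A no3B]]]] := exists_partition.
have suppG' x y : G x y -> x \in A :|: B by rewrite eqX; apply: suppG.
have cX : #|X| = #|A| + #|B| by rewrite -eqX cardsU disjoint_setI0 // cards0 subn0.
have AB4 : #|A| * #|B| <= #|X| ^ 2 %/ 4 by rewrite leq_divRL // mulnC cX nat_AGM2.
have [a ea] := dsum_even symG irrG A; have [b eb] := dsum_even symG irrG B.
have [a12 _ _ _] := card_deg2 symG irrG degA no3A; have [b12 _ _ _] := card_deg2 symG irrG degB no3B.
rewrite ea in a12; rewrite eb in b12.
apply: (@leq_trans (2 ^ (#|A| * #|B| + 6))); last by rewrite leq_exp2l // leq_add2r.
have [ab | ab] := leqP (a + b) 6.
  apply: (@leq_trans #|[set D | orients G D]|).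
    by apply: subset_leq_card; apply/subsetP => D; rewrite !inE => /andP[].
  rewrite card_orients // leq_exp2l //.
  (* Nothing is cut here, so this bounds the edges of [G] by [a + b + #|A| * #|B|]. *)
  have := edges_cut_le symG irrG suppG' (xs := [::]) (ys := [::]).
  have -> : #|edges (cut [::] G [::])| = #|edges G|.
    by apply: eq_card => p; rewrite !inE /cut andbT.
  rewrite ea eb => /(_ isT isT) le.
  have {}le := le (fun x => ltac:(done)) (fun x => ltac:(done)); move: le.
  rewrite muln0 addn0 -!mulnDr leq_pmul2l // => /leq_trans; apply.
  by rewrite addnC leq_add2l.
have [ba | ab'] := leqP b a.
  by apply: (mixed_le eqX dAB nAB degA degB no3A no3B ea eb ba) => //; move: a12 ab; clear; lia.
rewrite mulnC; apply: (mixed_le _ _ nBA degB degA no3B no3A eb ea (ltnW ab')).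
- by rewrite setUC.
- by rewrite disjoint_sym.
- by move: b12 ab; clear; lia.
by rewrite addnC.
Qed.
End NoGain.

(** * Progressive induction *)

(** With [q = i %/ 12 >= 8] one has [3 * i + 2 <= 2 ^ (q + 6)], and [12 + 6 * (q + 6) = 6 * q + 48
    <= 12 * q <= i]. *)
Lemma exp2_dominates i : 96 <= i -> 3200 * (3 * i + 2) ^ 6 <= 2 ^ i.
Proof.
move=> i96; pose q := i %/ 12; have q8 : 8 <= q by rewrite leq_divRL.
have le_q : 3 * i + 2 <= 2 ^ (q + 6).
  have := ltn_expl q (isT : 1 < 2); have := ltn_ceil i (isT : 0 < 12); rewrite -/q expnD.
  by move: (2 ^ q) => Q; clear; lia.
apply: (@leq_trans (2 ^ 12 * 2 ^ ((q + 6) * 6))).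
  by apply: leq_mul; rewrite ?expnM ?leq_exp2r //; lia.
by rewrite -expnD leq_exp2l //; have := leq_divM i 12; rewrite -/q; lia.
Qed.

(* [e] is of order [n^(2/3)], which dominates the error terms [n log n / e]. *)
Lemma exists_scales n : 2 ^ 300 <= n -> exists l e,
  [/\ 0 < l, n < 2 ^ l, l * (4 + n %/ e) + 20 <= e & 200 * (e * l ^ 6) <= n./2].
Proof.
move=> len; have n0 : 0 < n by apply: leq_trans len; rewrite expn_gt0.
have /andP[lo hi] := trunc_log_bounds (isT : 1 < 2) n0.
have l300 : 300 <= trunc_log 2 n by apply: trunc_log_max.
move: (trunc_log 2 n) lo hi l300 => k lo hi k300; pose l := k.+1; pose i := l %/ 3.
have i96 : 96 <= i by rewrite leq_divRL // /l; lia.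
have li : l <= 3 * i + 2 by have := ltn_ceil l (isT : 0 < 3); rewrite -/i; lia.
have il : 3 * i <= l by rewrite mulnC leq_divM.
have dom := exp2_dominates i96.
rewrite /l in li il; move: (i) i96 li il dom => {l}i i96 li il dom.
(* As [k.+1 <= 3 * i + 2], both [n %/ e] and [k.+1] are at most [2 ^ i]; their product is at most
   [4 ^ i], a quarter of [e]. *)
exists k.+1, (2 ^ (2 * i + 2)); split=> //.
- have ltq : n %/ 2 ^ (2 * i + 2) < 2 ^ i.
    rewrite ltn_divLR ?expn_gt0 // -expnD; apply: leq_trans hi _.
    by rewrite leq_exp2l //; move: li; clear; lia.
  have l2 : k.+1 <= 2 ^ i.
    apply: leq_trans dom; apply: leq_trans li _; rewrite -{1}(expn1 (3 * i + 2)).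
    apply: leq_trans (_ : (3 * i + 2) ^ 6 <= _); last by rewrite leq_pmull.
    by rewrite leq_pexp2l // addn2.
  have i20 : 20 <= 2 ^ i.
    by apply: (@leq_trans i); [apply: leq_trans i96 | apply: ltnW; apply: ltn_expl].
  have : k.+1 * (4 + n %/ 2 ^ (2 * i + 2)) <= 2 ^ i * (2 ^ i + 4).
    by rewrite leq_mul // addnC leq_add2r ltnW.
  rewrite -(leq_add2r 20) => /leq_trans; apply.
  rewrite (expnD 2 (2 * i)) (mulnC 2 i) expnM -mulnn.
  by move: (2 ^ i) i20; clear; nia.
apply: (@leq_trans (2 ^ k.-1)); last first.
  have -> : 2 ^ k.-1 = (2 ^ k)./2 by case: (k) k300 => // j _; rewrite expnS mul2n doubleK.
  exact: half_leq.
apply: (@leq_trans (200 * (2 ^ (2 * i + 2) * (3 * i + 2) ^ 6))).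
  by rewrite !leq_mul2l leq_exp2r // li !orbT.
apply: (@leq_trans (2 ^ (2 * i) * 2 ^ (i - 2))); last by rewrite -expnD leq_exp2l //; move: il i96; clear; lia.
have -> : 200 * (2 ^ (2 * i + 2) * (3 * i + 2) ^ 6) = 2 ^ (2 * i) * (800 * (3 * i + 2) ^ 6).
  by rewrite expnD; move: (2 ^ (2 * i)) (_ ^ 6); clear; nia.
rewrite leq_mul2l; apply/orP; right; rewrite -(leq_pmul2l (isT : 0 < 4)).
apply: (@leq_trans (2 ^ i)); last by rewrite -(expnD 2 2) leq_exp2l //; move: i96; clear; lia.
by apply: leq_trans dom; move: (_ ^ 6); clear; lia.
Qed.

(** The increment is the exponent in the gain condition, so a deletion with gain carries the bound
    from [m] to [m.+1] vertices. *)
Lemma sqr_div4S m : m.+1 ^ 2 %/ 4 = m ^ 2 %/ 4 + m.+1./2.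
Proof.
rewrite -(odd_double_half m) -muln2; set k := m./2; case: (odd m).
  have -> : (true + k * 2).+1 ^ 2 = (k.+1 * k.+1) * 4 by rewrite -mulnn; nia.
  have -> : (true + k * 2) ^ 2 = (k * k.+1) * 4 + 1 by rewrite -mulnn; nia.
  have -> : (true + k * 2).+1./2 = k.+1 by rewrite (_ : _.+1 = k.+1.*2) ?doubleK //; lia.
  by rewrite mulnK // divnMDl // addn0; nia.
have -> : (false + k * 2).+1 ^ 2 = (k * k.+1) * 4 + 1 by rewrite -mulnn; nia.
have -> : (false + k * 2) ^ 2 = (k * k) * 4 by rewrite -mulnn; nia.
have -> : (false + k * 2).+1./2 = k by rewrite add0n muln2 /= uphalf_double.
by rewrite mulnK // divnMDl // addn0; nia.
Qed.

(** Each deletion with gain saves an additional factor 2, collected in [2 ^ m]; the trivial count of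
    orientations starts this below [2 ^ 300] vertices. A graph without gain satisfies the first
    alternative, which deletions with gain preserve. *)
Lemma progressive_induction (V : finType) t0 t1 t2 m (G : rel V) (X : {set V}) :
  symmetric G -> irreflexive G -> (forall x y, G x y -> x \in X) -> #|X| = m ->
  #|Horients t0 t1 t2 G| <= 2 ^ (m ^ 2 %/ 4 + 6) \/
  2 ^ m * #|Horients t0 t1 t2 G| <= 2 ^ (m ^ 2 %/ 4 + (2 ^ 300 + (2 ^ 300) ^ 2)).
Proof.
(* The constant is generalised so that it is never computed. *)
move: (2 ^ 300) exists_scales => n0 scales.
elim: m G X => [|m IH] G X symG irrG suppG cX.
  left; apply: (@leq_trans #|[set D : {ffun V * V -> bool} | orients G D]|).
    by apply: subset_leq_card; apply/subsetP => D; rewrite !inE => /andP[].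
  rewrite card_orients // leq_exp2l // (_ : edges G = set0) ?cards0 //.
  apply/setP => -[x y]; rewrite !inE /=; apply/negP => /andP[/suppG].
  have -> : X = set0 by apply/eqP; rewrite -cards_eq0 cX.
  by rewrite inE.
have [small | large] := ltnP m.+1 n0.
  right; apply: (@leq_trans (2 ^ m.+1 * #|[set D : {ffun V * V -> bool} | orients G D]|)).
    by rewrite leq_mul2l subset_leq_card ?orbT //; apply/subsetP => D; rewrite !inE => /andP[].
  rewrite card_orients // -expnD leq_exp2l //.
  have : #|edges G| <= m.+1 ^ 2.
    rewrite -mulnn -cX -cardsX subset_leq_card //; apply/subsetP => -[x y].
    by rewrite !inE /= => /andP[xy _]; rewrite (suppG _ _ xy) (@suppG y x) // symG.
  have : m.+1 ^ 2 <= n0 ^ 2 by rewrite leq_exp2r // ltnW.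
  by move: small; clear; lia.
have [/forall_inP nogain | ] := boolP [forall v in X,
    #|Horients t0 t1 t2 (delG v G)| * 2 ^ (#|X|./2) < 2 * #|Horients t0 t1 t2 G|].
  left; rewrite -cX; rewrite -cX in large; have [l [e [h1 h2 h3 h4]]] := scales _ large.
  exact: (card_Horients_le symG irrG suppG nogain h1 h2 h3 h4).
move=> /forall_inPn[v vX]; rewrite -leqNgt cX => gain.
have cX' : #|X :\ v| = m by move: cX; rewrite (cardsD1 v) vX => -[].
have supp' x y : delG v G x y -> x \in X :\ v.
  by rewrite in_setD1 => /and3P[/suppG-> ->].
have [le | le] := IH _ _ (delG_sym v symG) (delG_irr v irrG) supp' cX'; [left | right].
  rewrite sqr_div4S -(leq_pmul2l (isT : 0 < 2)); apply: leq_trans gain _.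
  rewrite addnAC expnD mulnA leq_mul2r; apply/orP; right; apply: leq_trans le _.
  by rewrite leq_pmull.
rewrite sqr_div4S addnAC expnD expnS mulnAC (mulnC _ (2 ^ m)).
apply: leq_trans (_ : 2 ^ m * (#|Horients t0 t1 t2 (delG v G)| * 2 ^ (m.+1./2)) <= _).
  by rewrite leq_mul2l gain orbT.
by rewrite mulnA leq_mul2r le orbT.
Qed.

(** Once [n] reaches the constant of the second alternative, the saving [2 ^ n] outweighs it. *)
Lemma card_Horients_large n t0 t1 t2 (G : rel 'I_n) : symmetric G -> irreflexive G ->
  2 ^ 300 + (2 ^ 300) ^ 2 <= n -> #|Horients t0 t1 t2 G| <= 2 ^ (n ^ 2 %/ 4 + 6).
Proof.
move=> symG irrG len.
have supp x y : G x y -> x \in [set: 'I_n] by rewrite inE.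
have cT : #|[set: 'I_n]| = n by rewrite cardsT card_ord.
have [// | le] := progressive_induction t0 t1 t2 symG irrG supp cT.
move: (2 ^ 300 + _) len le => K len le.
rewrite -(leq_pmul2l (_ : 0 < 2 ^ n)) ?expn_gt0 //; apply: leq_trans le _.
rewrite -expnD leq_exp2l //; move: len (n ^ 2 %/ 4); clear; lia.
Qed.

(** * The types of the three triangles of H *)

Definition F33_nat (i j : nat) := (i != j) && [|| i == 0, j == 0 | (i.-1)./2 == (j.-1)./2].
(** Two bits per triangle determine [h]: the direction of the arc at [2 * k + 1] and that of the
    outer edge. An embedding can thus be checked triangle by triangle, on natural numbers in place
    of ordinals. *)
Lemma F33_nat_embedding (h R : nat -> nat -> bool) :
  (forall i j, i < 7 -> j < 7 -> h i j -> F33_nat i j) ->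
  (forall i, 0 < i < 7 -> h i 0 = ~~ h 0 i) ->
  (forall k, k < 3 -> h 0 (2 * k + 2) = ~~ h 0 (2 * k + 1)) ->
  (forall k, k < 3 -> h (2 * k + 2) (2 * k + 1) = ~~ h (2 * k + 1) (2 * k + 2)) ->
  (forall k, k < 3 -> if h 0 (2 * k + 1) then R 0 (2 * k + 1) && R (2 * k + 2) 0
                      else R (2 * k + 1) 0 && R 0 (2 * k + 2)) ->
  (forall k, k < 3 -> if h (2 * k + 1) (2 * k + 2) then R (2 * k + 1) (2 * k + 2)
                      else R (2 * k + 2) (2 * k + 1)) ->
  forall i j, i < 7 -> j < 7 -> h i j -> R i j.
Proof.
move=> hF h0 hs hr Rs Re i j i7 j7 hij.
have half k : k < 7 -> 0 < k -> exists2 t, t < 3 & k = 2 * t + 1 \/ k = 2 * t + 2.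
  by move=> k7 k0; exists (k.-1)./2; lia.
have /andP[nij F] := hF i j i7 j7 hij.
have [i0|i0] := posnP i.
  subst i; have j0 : 0 < j by rewrite lt0n eq_sym.
  have [t t3 [ej|ej]] := half j j7 j0; subst j; have := Rs t t3; first by rewrite hij => /andP[].
  by move: hij; rewrite (hs t t3) => /negPf-> /andP[].
have [j0|j0] := posnP j.
  subst j; have [t t3 [ei|ei]] := half i i7 i0; subst i; move: hij; rewrite h0 ?i0 // => hij; have := Rs t t3.
    by rewrite (negPf hij) => /andP[].
  by move: hij; rewrite (hs t t3) negbK => -> /andP[].
have eqt : (i.-1)./2 = (j.-1)./2.
  by apply/eqP; move: F; rewrite (gtn_eqF i0) (gtn_eqF j0).
have [t t3 ei] := half i i7 i0.
have [[e1 e2]|[e1 e2]] : i = 2 * t + 1 /\ j = 2 * t + 2 \/ i = 2 * t + 2 /\ j = 2 * t + 1.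
  by move: i0 j0 nij eqt ei; clear; lia.
  by have := Re t t3; rewrite -e1 -e2 hij.
by have := Re t t3; rewrite -e1 -e2; move: hij; rewrite e1 e2 (hr t t3) => /negPf->.
Qed.

(** The two arcs at the centre of an anti-directed triangle are opposite, so up to exchanging its
    outer vertices the triangle is cyclic or transitive. Three triangles of the right types sharing
    just their centre therefore contain [H]. *)
Lemma anti_directed_types (H : rel 'I_7) : anti_directed H -> exists t0 t1 t2,
  forall n (D : Defs.grel n), ~~ has_copy H (rel_of D) -> Hfree t0 t1 t2 D.
Proof.
move=> [/forallP oH adH].
pose h i j := H (inord i) (inord j).
have hF i j : i < 7 -> j < 7 -> (h i j -> F33_nat i j) /\ (F33_nat i j -> h j i = ~~ h i j).
  move=> i7 j7; have /forallP/(_ (inord j))/andP[/implyP h1 /implyP h2] := oH (inord i).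
  rewrite /F33 -val_eqE /= !inordK // in h1 h2; split; first exact: h2.
  by move=> /h1; rewrite /h; case: (H _ _); case: (H _ _).
have h0 : centre = inord 0 by apply: val_inj; rewrite /= inordK.
have dir (k : 'I_3) : h 0 (2 * k + 2) = ~~ h 0 (2 * k + 1).
  have k1 : 2 * k + 1 < 7 by have := ltn_ord k; lia.
  have k2 : 2 * k + 2 < 7 by have := ltn_ord k; lia.
  have [[v [v1 v0 vin]] [w [w1 w0 wout]]] := adH k.
  have vE : v = 2 * k + 1 :> nat \/ v = 2 * k + 2 :> nat.
    have : (v : nat) != 0 by rewrite -val_eqE in v0.
    by move: v1; move: (nat_of_ord v) (nat_of_ord k); clear; lia.
  have wE : w = 2 * k + 1 :> nat \/ w = 2 * k + 2 :> nat.
    have : (w : nat) != 0 by rewrite -val_eqE in w0.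
    by move: w1; move: (nat_of_ord w) (nat_of_ord k); clear; lia.
  rewrite h0 -[v]inord_val -/(h v 0) in vin; rewrite h0 -[w]inord_val -/(h 0 w) in wout.
  have [_ e1] := hF 0 _ isT k1; have [_ e2] := hF 0 _ isT k2.
  rewrite !addnS /= in e1 e2 *; have {}e1 := e1 isT; have {}e2 := e2 isT.
  move: vin wout; case: vE => ->; case: wE => ->; rewrite !addnS ?e1 ?e2.
  - by move=> /negPf->.
  - by move=> /negPf-> ->.
  - by move=> /negPf-> ->.
  by move=> /negPf->.
(* Triangle [k] is cyclic exactly when its arcs from 0 to [2 * k + 1] and on to [2 * k + 2] are both
   present or both reversed. *)
pose t k := h (2 * k + 1) (2 * k + 2) == h 0 (2 * k + 1).
exists (t 0), (t 1), (t 2) => n D; apply: contraNT => /negPn.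
case/existsP=> x /existsP[a0 /existsP[b0 /existsP[a1 /existsP[b1]]]].
case/existsP=> a2 /existsP[b2 /and4P[U T0 T1 T2]].
(* [tri] does not distinguish the outer vertices; they are renamed so that [y] plays [2 * k + 1] and
   [z] plays [2 * k + 2]. *)
have sel (c d : bool) a b : tri (d == c) D x a b -> exists y z,
    [/\ perm_eq [:: a; b] [:: y; z], if c then D (x, y) && D (z, x) else D (y, x) && D (x, z)
     & if d then D (y, z) else D (z, y)].
  have swap : perm_eq [:: a; b] [:: b; a] by rewrite (perm_catC [:: a] [:: b]).
  by case: c; case: d => /orP[] /and3P[e1 e2 e3]; first
    [by exists a, b; rewrite ?e1 ?e2 ?e3 | by exists b, a; rewrite ?e1 ?e2 ?e3].
have [y1 [z1 [p1 c1 d1]]] := sel _ _ _ _ T0.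
have [y2 [z2 [p2 c2 d2]]] := sel _ _ _ _ T1.
have [y3 [z3 [p3 c3 d3]]] := sel _ _ _ _ T2.
pose ys := [:: x; y1; z1; y2; z2; y3; z3].
have Uys : uniq ys.
  rewrite -(perm_uniq (s1 := [:: x; a0; b0; a1; b1; a2; b2])) //.
  rewrite perm_cons; apply: (perm_cat (s1 := [:: a0; b0]) (s2 := [:: y1; z1])) => //.
  by apply: (perm_cat (s1 := [:: a1; b1]) (s2 := [:: y2; z2])).
apply/existsP; exists [ffun u : 'I_7 => nth x ys u]; apply/andP; split.
  apply/injectiveP => u v; rewrite !ffunE => /eqP; rewrite nth_uniq // => /eqP.
  exact: val_inj.
apply/forallP => u; apply/forallP => v; apply/implyP; rewrite !ffunE /rel_of.
rewrite -{1}[u]inord_val -{1}[v]inord_val -/(h u v).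
have k3 k : k < 3 -> [\/ k = 0, k = 1 | k = 2].
  by case: k => [|[|[|]]] // _; [constructor 1 | constructor 2 | constructor 3].
apply: (@F33_nat_embedding h (fun i j => D (nth x ys i, nth x ys j))) => //.
- by move=> i j i7 j7; have [] := hF i j i7 j7.
- by move=> i /andP[i0 i7]; have [_] := hF 0 i isT i7; apply; rewrite /F33_nat /= eq_sym -lt0n i0.
- by move=> k klt; have := dir (Ordinal klt).
- by move=> k /k3[]->; [have [_] := hF 1 2 isT isT | have [_] := hF 3 4 isT isT |
    have [_] := hF 5 6 isT isT]; apply.
- move=> k /k3[]->; [exact: c1 | exact: c2 | exact: c3].
by move=> k /k3[]->; [exact: d1 | exact: d2 | exact: d3].
Qed.

(** * The extremal graph *)

(* The last disjunct adds the triangles {0, 1, 2} and {3, 4, 5} inside [0, k). *)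
Definition extremal_rel (k x y : nat) :=
  ((x < k) != (y < k)) || [&& x != y, x < 6, y < 6 & x %/ 3 == y %/ 3].

Definition extremal n : Defs.grel n := [ffun p : 'I_n * 'I_n => extremal_rel n./2 p.1 p.2].

Lemma simple_extremal n : simpleb (rel_of (extremal n)).
Proof.
apply/andP; split; apply/forallP => x; first by rewrite /rel_of ffunE /extremal_rel !eqxx.
apply/forallP => y; rewrite /rel_of !ffunE /extremal_rel /= (eq_sym (x < _)).
by rewrite (eq_sym (x : nat)) (eq_sym (x %/ 3)) (andbCA (x < 6)).
Qed.

Lemma third_pigeonhole a b c d : a %/ 3 = b %/ 3 -> a %/ 3 = c %/ 3 -> a %/ 3 = d %/ 3 ->
  ~~ uniq [:: a; b; c; d].
Proof.
move=> eb ec ed; rewrite /= !inE !negb_or -!andbA; apply/negP.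
by case/and5P=> n1 n2 n3 n4 /and3P[n5 n6 _]; move: eb ec ed n1 n2 n3 n4 n5 n6; lia.
Qed.

(** If the centre is at least [k], all other vertices are below [k], and three disjoint edges would
    lie in two triangles, so one triangle would hold four vertices. If the centre is below [k], each
    triangle of the copy has a further vertex below [k], and the centre with these three would be
    four vertices in one triangle. *)
Lemma extremal_F33_free n : 12 <= n -> ~~ has_copy F33 (rel_of (extremal n)).
Proof.
move=> n12; apply/negP => /existsP[f /andP[/injectiveP injf /forallP Ff]].
have k6 : 6 <= n./2 by rewrite -[6]/(12./2) half_leq.
pose g i : nat := f (inord i).
have ug s : uniq s -> all (fun i => i < 7) s -> uniq (map g s).
  move=> us /allP s7; rewrite map_inj_in_uniq // => i j /s7 i7 /s7 j7 /val_inj/injf eqij.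
  by rewrite -(inordK i7) -(inordK j7) eqij.
have gE i j : i < 7 -> j < 7 -> F33_nat i j -> extremal_rel n./2 (g i) (g j).
  move=> i7 j7 Fij; have /forallP/(_ (inord j))/implyP := Ff (inord i).
  rewrite /F33 -val_eqE /= !inordK // => /(_ Fij).
  by rewrite /rel_of ffunE.
move: (n./2) k6 gE => k k6 gE.
have low x y : x < k -> y < k -> extremal_rel k x y -> [/\ x < 6, y < 6 & x %/ 3 = y %/ 3].
  by rewrite /extremal_rel => -> -> /= /and4P[_ -> -> /eqP].
have high x y : k <= x -> extremal_rel k x y -> y < k.
  move=> kx; rewrite /extremal_rel (ltnNge x k) kx (ltnNge x 6) (leq_trans k6 kx) /= andbF orbF.
  by case: (y < k).
have spoke i : 0 < i < 7 -> extremal_rel k (g 0) (g i).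
  by case/andP=> i0 i7; apply: gE; rewrite // /F33_nat eq_sym -lt0n i0.
have [ck | kc] := ltnP (g 0) k; last first.
  have lt i : 0 < i < 7 -> g i < k by move/spoke; apply: high.
  have block i : i \in [:: 1; 3; 5] -> g i < 6 /\ g i %/ 3 = g i.+1 %/ 3.
    rewrite !inE => /or3P[]/eqP->.
    - by have [|//||] := low (g 1) (g 2); rewrite ?lt // gE.
    - by have [|//||] := low (g 3) (g 4); rewrite ?lt // gE.
    by have [|//||] := low (g 5) (g 6); rewrite ?lt // gE.
  have clash i j : i \in [:: 1; 3; 5] -> j \in [:: 1; 3; 5] -> g i %/ 3 = g j %/ 3 -> i = j.
    move=> iP jP eqb; apply/eqP/negPn/negP => nij.
    have [_ ei] := block i iP; have [_ ej] := block j jP.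
    have /negP := third_pigeonhole ei eqb (etrans eqb ej); apply.
    apply: (ug [:: i; i.+1; j; j.+1]);
      by move: iP jP nij; rewrite !inE => /or3P[]/eqP-> /or3P[]/eqP->.
  have [b1 _] := block 1 isT; have [b3 _] := block 3 isT; have [b5 _] := block 5 isT.
  have [e|[e|e]] : g 1 %/ 3 = g 3 %/ 3 \/ g 1 %/ 3 = g 5 %/ 3 \/ g 3 %/ 3 = g 5 %/ 3.
    by move: b1 b3 b5; move: (g 1) (g 3) (g 5); clear; lia.
  - by have := clash 1 3 isT isT e.
  - by have := clash 1 5 isT isT e.
  by have := clash 3 5 isT isT e.
have near i : i \in [:: 1; 3; 5] -> exists2 j, j \in [:: i; i.+1] & g 0 %/ 3 = g j %/ 3.
  move=> iP; have i7 : 0 < i < 7 by move: iP; rewrite !inE => /or3P[]/eqP->.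
  have i7' : 0 < i.+1 < 7 by move: iP; rewrite !inE => /or3P[]/eqP->.
  have [lti | gei] := ltnP (g i) k.
    by exists i; rewrite ?mem_head //; have [] := low _ _ ck lti (spoke i i7).
  have lti : g i.+1 < k.
    by apply: high gei _; apply: gE; move: iP; rewrite !inE => /or3P[]/eqP->.
  by exists i.+1; rewrite ?inE ?eqxx ?orbT //; have [] := low _ _ ck lti (spoke _ i7').
have [j1 j1P e1] := near 1 isT; have [j3 j3P e3] := near 3 isT; have [j5 j5P e5] := near 5 isT.
have /negP := third_pigeonhole e1 e3 e5; apply; apply: (ug [:: 0; j1; j3; j5]);
  by move: j1P j3P j5P; rewrite !inE => /orP[]/eqP-> /orP[]/eqP-> /orP[]/eqP->.
Qed.

Lemma card_ord_lt n k : k <= n -> #|[set x : 'I_n | x < k]| = k.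
Proof.
move=> kn; have inj : injective (widen_ord kn) by move=> x y /(congr1 val)/= /val_inj.
rewrite -[RHS]card_ord -(card_imset [pred x | true] inj); apply: eq_card => x; rewrite inE.
apply/idP/imsetP => [xk | [y _ ->]]; last by rewrite /= ltn_ord.
by exists (Ordinal xk) => //; apply: val_inj.
Qed.

Lemma nedges_extremal n : 12 <= n -> n ^ 2 %/ 4 + 6 <= nedges (rel_of (extremal n)).
Proof.
move=> n12; pose k := n./2; have k6 : 6 <= k by rewrite -[6]/(12./2) half_leq.
have kn : k <= n by rewrite /k; lia.
pose lo := [set x : 'I_n | x < k].
pose P6 := [set p : 'I_6 * 'I_6 | (p.1 < p.2) && (p.1 %/ 3 == p.2 %/ 3)].
have n6 : 6 <= n by apply: leq_trans n12.
pose w (p : 'I_6 * 'I_6) := (widen_ord n6 p.1, widen_ord n6 p.2).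
have injw : injective w.
  by move=> [x y] [x' y'] []/val_inj/= -> /val_inj/= ->.
have c6 : #|P6| = 6.
  rewrite -sum1dep_card -(pair_big_dep xpredT (fun x y : 'I_6 => (x < y) && (x %/ 3 == y %/ 3)) (fun _ _ => 1)) /=.
  under eq_bigr do rewrite big_mkcond.
  by rewrite !big_ord_recl !big_ord0.
(* The edges across the parts number [k * (n - k)], the integer part of [n ^ 2 / 4], and [P6] lists
   the six edges of the two triangles. *)
apply: (@leq_trans #|setX lo (~: lo) :|: w @: P6|).
  rewrite cardsU disjoint_setI0; last first.
    rewrite disjoint_subset; apply/subsetP => -[x y] /setXP[p1 p2]; rewrite inE.
    apply/imsetP => -[q _ [_ eqy]]; move: p2; rewrite eqy !inE /= => /negP; apply.
    exact: leq_trans (ltn_ord _) k6.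
  rewrite cards0 subn0 cardsX (cardsCs (~: lo)) setCK card_ord_lt // card_ord card_imset // c6 leq_add2r.
  rewrite -ltnS ltn_divLR // -{1 2}(odd_double_half n) -/k -mulnn -muln2.
  by move: (k); case: (odd n); clear; nia.
apply: subset_leq_card; apply/subsetP => -[x y]; rewrite !inE => /orP[/andP[/= xk yk]|/imsetP[[u v]]].
  rewrite /rel_of ffunE /extremal_rel /= -/k xk (negPf yk) /=.
  by apply: leq_trans xk _; rewrite leqNgt.
rewrite inE /= => /andP[uv e3] [-> ->]; rewrite /rel_of ffunE /extremal_rel /= uv andbT.
by rewrite !ltn_ord e3 (ltn_eqF uv) orbT.
Qed.

Lemma nedgesE n (G : rel 'I_n) : nedges G = #|edges G|.
Proof. by apply: eq_card => -[x y]; rewrite !inE /= !enum_rank_ord. Qed.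

Lemma simplebP n (G : rel 'I_n) : simpleb G -> symmetric G /\ irreflexive G.
Proof.
case/andP=> /forallP irrG /forallP symG; split=> [x y | x]; last exact: negbTE.
by have /forallP/(_ y)/eqP := symG x.
Qed.

Theorem mainTheorem5 (H : rel 'I_7) :
  anti_directed H ->
  exists N : nat, forall n : nat, N <= n ->
    Dnum H n = 2 ^ ex F33 n /\ ex F33 n = n ^ 2 %/ 4 + 6.
Proof.
move=> adH; have [t0 [t1 [t2 free]]] := anti_directed_types adH.
exists (2 ^ 300 + (2 ^ 300) ^ 2) => n len.
have n12 : 12 <= n.
  apply: leq_trans len; apply: (@leq_trans (2 ^ 300)); last exact: leq_addr.
  by apply: (@leq_trans (2 ^ 4)); [| rewrite leq_exp2l].
have upper : Dnum H n <= 2 ^ (n ^ 2 %/ 4 + 6).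
  apply/bigmax_leqP => G /simplebP[symG irrG].
  apply: leq_trans (card_Horients_large t0 t1 t2 symG irrG len).
  apply: subset_leq_card; apply/subsetP => D; rewrite !inE => /andP[oD /free fD].
  by apply/andP; split.
(* A copy of [H] in an orientation of [G] yields a copy of [F33] in [G], so all orientations of an
   [F33]-free graph count. *)
have lower (G : Defs.grel n) : simpleb (rel_of G) -> ~~ has_copy F33 (rel_of G) ->
    2 ^ nedges (rel_of G) <= Dnum H n.
  move=> sG fG; have [symG irrG] := simplebP sG.
  rewrite nedgesE -card_orients //.
  apply: (bigmax_sup G) => //; apply: subset_leq_card; apply/subsetP => D.
  rewrite !inE => oD; apply/andP; split=> //; apply: contra fG => /existsP[f /andP[injf /forallP Hf]].
  apply/existsP; exists f; rewrite injf; apply/forallP => u; apply/forallP => v; apply/implyP => Fuv.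
  have [_ sub] := orientsP _ symG oD.
  have [/forallP oH _] := adH; have /forallP/(_ v)/andP[/implyP/(_ Fuv) Huv _] := oH u.
  have HD a b : H a b -> D (f a, f b) by have /forallP/(_ b)/implyP := Hf a.
  have [/HD/sub // | nuv] := boolP (H u v).
  have /HD/sub : H v u by move: Huv; rewrite (negPf nuv).
  by rewrite symG.
have lowx := lower _ (simple_extremal n) (extremal_F33_free n12).
(* Through [lower], the bound on the number of orientations becomes the upper bound on the edges of
   an [F33]-free graph. *)
have exE : ex F33 n = n ^ 2 %/ 4 + 6.
  apply/eqP; rewrite eqn_leq; apply/andP; split.
    apply/bigmax_leqP => G /andP[sG fG].
    by rewrite -(leq_exp2l _ _ (isT : 1 < 2)) (leq_trans (lower G sG fG)).
  apply: leq_trans (nedges_extremal n12) _; apply: (bigmax_sup (extremal n)) => //.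
  by rewrite simple_extremal extremal_F33_free.
split=> //; apply/eqP; rewrite eqn_leq exE upper /= (leq_trans _ lowx) //.
by rewrite leq_exp2l // nedges_extremal.
Qed.
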